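(* Let $G\cong\pi_1X$, where $X$ is a compact special cube complex, and let $\mathcal S$ be a finite generating set of $G$. For each $R$, let $\mathcal Q_R$ be the class of subgroups of $G$ represented by compact local isometries to $X$ whose domains have at most $R$ vertices. Then there is a constant $P$, depending only on the generating set $\mathcal S$, such that $$\mathbf{Sep}^{\mathcal Q_R}_{G,\mathcal S}(Q,n)\leq PRn$$ for all $Q\in\mathcal Q_R$ and $n\in\mathbb N$. Hence, letting $\mathcal Q'_K$ be the class of subgroups $Q\leq G$ such that the convex hull of $Q\tilde x$ lies in $\mathcal N_K(Q\tilde x)$, where $\tilde x\in\widetilde X^{(0)}$, one has $$\mathbf{Sep}^{\mathcal Q'_K}_{G,\mathcal S}(Q,n)\leq P'\,\mathrm{gr}_{\widetilde X}(K)\,n$$ for all $Q\in\mathcal Q'_K$ and $n\in\mathbb N$, where $P'$ depends only on $G,\widetilde X,\mathcal S$, and $\mathrm{gr}_{\widetilde X}$ is the growth function of $\widetilde X^{(0)}$.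
   Context: Separability growth: let $G$ be a group generated by a finite set $\mathcal S$, with word length $\|\cdot\|_{\mathcal S}$. For $H\leq G$ and $g\in G-H$, let $D_G^{\Omega_H}(g)=\min\{[G:\Delta] : H\leq\Delta\leq G,\ g\notin\Delta\}\in\mathbb N\cup\{\infty\}$. For a class $\mathcal Q$ of subgroups of $G$, $Q\in\mathcal Q$ and $n\in\mathbb N$, $$\mathbf{Sep}^{\mathcal Q}_{G,\mathcal S}(Q,n)=\max\{D_G^{\Omega_Q}(g): g\in G-Q,\ \|g\|_{\mathcal S}\leq n\},$$ with the maximum of the empty set taken to be $0$. Right-angled Artin groups and Salvetti complexes: for a simplicial graph $\Gamma$, $A_\Gamma=\langle V(\Gamma)\mid [v,w],\ \{v,w\}\in E(\Gamma)\rangle$, and $S_\Gamma$ is the nonpositively-curved cube complex with one $0$-cube, one oriented $1$-cube labeled $v$ for each vertex $v$, and an $n$-torus ($n$-cube with opposite faces identified) for each $n$-clique of $\Gamma$; $\pi_1S_\Gamma\cong A_\Gamma$. Local isometry: a locally injective combinatorial map $\phi:Y\to X$ of cube complexes such that whenever $e_1,\dots,e_n$ are (ends of) $1$-cubes of $Y$ incident to a $0$-cube $y$ and the images $\phi(e_1),\dots,\phi(e_n)$ all lie in a common $n$-cube $c$ at the corner $\phi(y)$, then $e_1,\dots,e_n$ span an $n$-cube $c'$ of $Y$ with $\phi(c')=c$. Local isometries to nonpositively-curved cube complexes are $\pi_1$-injective. Special: a (connected) cube complex $X$ is special if there is a simplicial graph $\Gamma$ and a local isometry $X\to S_\Gamma$.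 Its universal cover $\widetilde X$ is a CAT(0) cube complex. Conventions: a base $0$-cube $x\in X$ and a lift $\tilde x\in\widetilde X^{(0)}$ of $x$ are fixed, $G$ is identified with $\pi_1(X,x)$, and $G$ acts on $\widetilde X$ by deck transformations accordingly. A subgroup $Q\leq G$ is represented by a compact local isometry if there is a compact connected cube complex $Z$ with a base $0$-cube and a based local isometry $Z\to (X,x)$ such that $Q$ is the image of $\pi_1Z$ in $\pi_1(X,x)$. A subcomplex of $\widetilde X$ is convex if it is full (it contains every cube whose $1$-skeleton it contains), and its $1$-skeleton is geodesically convex in the graph $\widetilde X^{(1)}$; the convex hull of a set is the intersection of all convex subcomplexes containing it. $\mathcal N_K(Q\tilde x)$ is the $K$-neighborhood of the orbit, i.e. the condition says that every $0$-cube of the convex hull is at distance at most $K$ from $Q\tilde x$ in the graph metric on $\widetilde X^{(1)}$. $\mathrm{gr}_{\widetilde X}(K)$ is the number of $0$-cubes of $\widetilde X$ at graph distance at most $K$ from $\tilde x$. *)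

(* Defs.v *)
From HB Require Import structures.
From Stdlib Require Import Relations.
From Stdlib Require List.
From mathcomp Require Import all_boot.
From mathcomp Require Import boolp classical_sets cardinality.

Set Implicit Arguments.
Unset Strict Implicit.
Unset Printing Implicit Defensive.

Local Open Scope classical_set_scope.
Local Open Scope card_scope.

(* [None] is infinity. *)
Definition enat := option nat.

Definition ele (a b : enat) : Prop :=
  match a, b with
  | _, None => True
  | Some m, Some n => m <= n
  | None, Some _ => False
  end.

Definition leastn (P : set nat) : enat :=
  match pselect (exists k, `[< P k >]) with
  | left h => Some (ex_minn h)
  | right _ => None
  end.

Definition emin (A : set enat) : enat := leastn [set k | A (Some k)].

(* Least upper bound: the maximum whenever there is one, and 0 if A is empty. *)
Definition emax (A : set enat) : enat :=
  leastn [set k | forall a, A a -> ele a (Some k)].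

Definition ecard (T : Type) (A : set T) : enat := leastn [set k | A #= `I_k].

Section SeparabilityGrowth.
Variable G : groupType.
Implicit Types (S H D Q : set G) (g : G).
Local Open Scope group_scope.

Definition subgroup H : Prop :=
  [/\ H 1, (forall g h, H g -> H h -> H (g * h)) & forall g, H g -> H g^-1].

Definition word S (w : seq G) : Prop :=
  List.Forall (fun a => S a \/ S a^-1) w.

Definition generates S : Prop :=
  forall g, exists2 w, word S w & \prod_(a <- w) a = g.

Definition word_length S g : enat :=
  leastn [set k | exists w, [/\ word S w, \prod_(a <- w) a = g & size w = k]].

Definition index D : enat :=
  ecard [set C | exists g, C = [set g * d | d in D]].

Definition Dsep H g : enat :=
  emin [set index D | D in [set D | [/\ subgroup D, H `<=` D & ~ D g]]].

Definition Sep S Q (n : nat) : enat :=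
  emax [set Dsep Q g | g in [set g | ~ Q g /\ ele (word_length S g) (Some n)]].

End SeparabilityGrowth.

(* An isometry of [0,1]^m onto an m-dimensional face of [0,1]^n: the vertex 0
   goes to [fbase], and the i-th axis direction goes, up to sign, to the
   [fdir i]-th one; the sign is negative exactly when [fbase (fdir i)]. *)
Record face (m n : nat) := Face {
  fdir : {ffun 'I_m -> 'I_n};
  fbase : {ffun 'I_n -> bool};
  _ : injectiveb fdir }.

Definition fvert m n (f : face m n) (u : {ffun 'I_m -> bool}) :
    {ffun 'I_n -> bool} :=
  [ffun j => fbase f j (+) [exists i, (fdir f i == j) && u i]].

Lemma fdir_inj m n (f : face m n) : injective (fdir f).
Proof. by case: f => d b H; exact/injectiveP. Qed.

Fact face_id_subproof n : injectiveb [ffun i : 'I_n => i].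
Proof. by apply/injectiveP => i j; rewrite !ffunE. Qed.

Definition face_id n : face n n :=
  Face [ffun=> false] (face_id_subproof n).

Fact face_comp_subproof m n p (g : face n p) (f : face m n) :
  injectiveb [ffun i => fdir g (fdir f i)].
Proof.
by apply/injectiveP => i j; rewrite !ffunE => /fdir_inj /fdir_inj.
Qed.

Definition face_comp m n p (g : face n p) (f : face m n) : face m p :=
  Face (fvert g (fbase f)) (face_comp_subproof g f).

Fact vertex_face_subproof n :
  injectiveb [ffun i : 'I_0 => widen_ord (leq0n n) i].
Proof. by apply/injectiveP => -[]. Qed.

Definition vertex_face n (u : {ffun 'I_n -> bool}) : face 0 n :=
  Face u (vertex_face_subproof n).

Fact edge_face_subproof n (i : 'I_n) : injectiveb [ffun _ : 'I_1 => i].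
Proof. by apply/injectiveP => j k _; rewrite !ord1. Qed.

Definition edge_face n (i : 'I_n) (u : {ffun 'I_n -> bool}) : face 1 n :=
  Face u (edge_face_subproof i).

(* [cube X n] is the set of *parametrized* n-cubes of X: n-cubes c together
   with an isometry [0,1]^n -> c, so that each n-cube accounts for 2^n n!
   elements.  [restr f] is precomposition with [f].  The last axiom says that
   distinct parametrizations of a cube are distinct, i.e. that the interior of
   a cube embeds in X. *)
Record cube_complex := CubeComplex {
  cube :> nat -> Type;
  restr : forall m n, face m n -> cube n -> cube m;
  restr_id : forall n (c : cube n), restr (face_id n) c = c;
  restr_comp : forall m n p (g : face n p) (f : face m n) (c : cube p),
    restr (face_comp g f) c = restr f (restr g c);
  restr_free : forall n (f : face n n) (c : cube n),
    restr f c = c -> f = face_id n }.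

Arguments restr {X m n} f c : rename.

Section Paths.
Variable X : cube_complex.

Definition vert n (c : X n) (u : {ffun 'I_n -> bool}) : X 0 :=
  restr (vertex_face u) c.
Definition origin n (c : X n) : X 0 := vert c [ffun=> false].
Definition edge_at n (c : X n) (i : 'I_n) (u : {ffun 'I_n -> bool}) : X 1 :=
  restr (edge_face i u) c.
Definition corner_edge n (c : X n) (i : 'I_n) : X 1 :=
  edge_at c i [ffun=> false].

(* A parametrized 1-cube is an oriented 1-cube, equivalently an end of a
   1-cube, namely the end at its source. *)
Definition src (e : X 1) : X 0 := origin e.
Definition tgt (e : X 1) : X 0 := vert e [ffun=> true].
Definition erev (e : X 1) : X 1 := edge_at e ord0 [ffun=> true].

Fixpoint epath (x : X 0) (p : seq (X 1)) (y : X 0) : Prop :=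
  match p with
  | [::] => x = y
  | e :: q => src e = x /\ epath (tgt e) q y
  end.

Definition vtx10 : {ffun 'I_2 -> bool} := [ffun j => j == ord0].
Definition vtx01 : {ffun 'I_2 -> bool} := [ffun j => j == ord_max].

(* [across_square] exchanges the two paths 00 -> 10 -> 11 and 00 -> 01 -> 11
   along the boundary of a square. *)
Inductive elementary : seq (X 1) -> seq (X 1) -> Prop :=
| backtrack p e q : elementary (p ++ e :: erev e :: q) (p ++ q)
| across_square p (c : X 2) q : elementary
    (p ++ corner_edge c ord0 :: edge_at c ord_max vtx10 :: q)
    (p ++ corner_edge c ord_max :: edge_at c ord0 vtx01 :: q).

Definition homotopic (x y : X 0) : relation (seq (X 1)) :=
  clos_refl_sym_trans _ (fun p q =>
    [/\ epath x p y, epath x q y & elementary p q]).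

Definition connected : Prop := forall x y : X 0, exists p, epath x p y.

Definition compact : Prop := finite_set [set: {n : nat & X n}].

Definition dist (x y : X 0) : enat :=
  leastn [set k | exists2 p, epath x p y & size p = k].

Definition geodesic (x : X 0) (p : seq (X 1)) (y : X 0) : Prop :=
  epath x p y /\ forall q, epath x q y -> size p <= size q.

End Paths.

Section PathAlgebra.
Variable X : cube_complex.
Implicit Types (x y z : X 0) (e : X 1) (p q r : seq (X 1)).

Lemma restr_eq m n (f g : face m n) (c : X n) :
  fdir f =1 fdir g -> fbase f =1 fbase g -> restr f c = restr g c.
Proof.
case: f g => [d b H] [d' b' H'] /= /ffunP E /ffunP E'.
by subst; rewrite (bool_irrelevance H H').
Qed.

Lemma src_erev e : src (erev e) = tgt e.
Proof.
rewrite /src /tgt /erev /origin /vert /edge_at -restr_comp.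
apply: restr_eq => i; first by case: i.
rewrite /= !ffunE /=.
by case: existsP => // -[k]; rewrite !ffunE andbF.
Qed.

Lemma tgt_erev e : tgt (erev e) = src e.
Proof.
rewrite /src /tgt /erev /origin /vert /edge_at -restr_comp.
apply: restr_eq => i; first by case: i.
rewrite /= !ffunE /=.
case: existsP => //= -[]; exists ord0.
by rewrite !ffunE andbT ord1.
Qed.

Lemma erevK e : erev (erev e) = e.
Proof.
rewrite -[RHS]restr_id /erev /edge_at -restr_comp.
apply: restr_eq => i; first by rewrite /= !ffunE ord1.
rewrite /= !ffunE /=.
case: existsP => //= -[]; exists ord0.
by rewrite !ffunE andbT ord1.
Qed.

Lemma epath_cat x p q z :
  epath x (p ++ q) z <-> exists2 y, epath x p y & epath y q z.
Proof.
elim: p x => [|e p IH] x /=.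
  by split=> [H|[y <-]]; [exists x|].
by split=> [[E /IH[y ? ?]]|[y [E ?] ?]];
  [exists y | split=> //; apply/IH; exists y].
Qed.

Definition prev p : seq (X 1) := rev (map (@erev X) p).

Lemma prev_cons e p : prev (e :: p) = prev p ++ [:: erev e].
Proof. by rewrite /prev /= rev_cons -cats1. Qed.

Lemma epath_prev x p y : epath x p y -> epath y (prev p) x.
Proof.
elim: p x => [|e p IH] x /=; first by move=> ->.
case=> E /IH H; rewrite prev_cons; apply/epath_cat.
exists (tgt e); first exact: H.
by split; [exact: src_erev | rewrite -E; exact: tgt_erev].
Qed.

Lemma homotopic_cat x y z p p' q q' :
    epath x p y -> epath y q z ->
  homotopic x y p p' -> homotopic y z q q' ->
  homotopic x z (p ++ q) (p' ++ q').
Proof.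
move=> px qy hp hq.
have hpy : homotopic x z (p ++ q) (p' ++ q).
  elim: hp => {p p' px} [p p'|p|p p' _|p p' p'' _ + _].
  - case=> h h' el; apply: rst_step; split.
    + by apply/epath_cat; exists y.
    + by apply/epath_cat; exists y.
    + by case: el => *; rewrite -!catA /=; constructor.
  - exact: rst_refl.
  - exact: rst_sym.
  - exact: rst_trans.
apply: (rst_trans _ _ _ _ _ hpy).
have {px hpy}px' : epath x p' y.
  have -> : epath x p' y = epath x p y.
    apply/propext; elim: hp => {p p' px hpy} [p p'|p|p p' _|p p' p'' _ + _].
    - by case.
    - by [].
    - by move=> [].
    - by move=> [h1 h2] [h3 h4]; split; tauto.
  exact: px.
elim: hq => {q q' qy} [q q'|q|q q' _|q q' q'' _ + _].
- case=> h h' el; apply: rst_step; split.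
  + by apply/epath_cat; exists y.
  + by apply/epath_cat; exists y.
  + by case: el => *; rewrite !catA; constructor.
- exact: rst_refl.
- exact: rst_sym.
- exact: rst_trans.
Qed.

Lemma homotopic_prev x y p : epath x p y -> homotopic x x (p ++ prev p) [::].
Proof.
elim: p x => [|e p IH] x /=; first by move=> _; apply: rst_refl.
case=> E h; rewrite prev_cons catA.
have he : epath x [:: e] (tgt e) by [].
have hr : epath (tgt e) [:: erev e] x.
  by split; [exact: src_erev | rewrite -E; exact: tgt_erev].
have hpp : epath (tgt e) (p ++ prev p) (tgt e).
  by apply/epath_cat; exists y => //; apply: epath_prev.
apply: (rst_trans _ _ _ ([:: e] ++ ([::] ++ [:: erev e]))).
  apply: (@homotopic_cat _ _ _ [:: e]) he _ (rst_refl _ _ _) _.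
    by apply/epath_cat; exists (tgt e).
  exact: homotopic_cat hpp hr (IH _ h) (rst_refl _ _ _).
apply: rst_step; split=> //.
exact: (backtrack [::]).
Qed.

End PathAlgebra.

Record pi1 (X : cube_complex) (x : X 0) := Pi1 {
  loops : set (seq (X 1));
  _ : exists2 p, epath x p x & loops = homotopic x x p }.

HB.instance Definition _ X x := gen_eqMixin (@pi1 X x).
HB.instance Definition _ X x := gen_choiceMixin (@pi1 X x).

Section Pi1.
Variables (X : cube_complex) (x : X 0).
Implicit Types a b : pi1 x.

Definition pi1_class p (hp : epath x p x) : pi1 x :=
  Pi1 (ex_intro2 _ _ p hp erefl).

Fact pi1_rep_subproof a : exists p, epath x p x /\ loops a p.
Proof. by case: a => A /= [p hp ->]; exists p; split=> //; apply: rst_refl. Qed.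

Definition rep a : seq (X 1) := sval (cid (pi1_rep_subproof a)).

Lemma rep_epath a : epath x (rep a) x.
Proof. by rewrite /rep; case: cid => p []. Qed.

Lemma loops_rep a : loops a (rep a).
Proof. by rewrite /rep; case: cid => p []. Qed.

Lemma pi1_ext a b : loops a = loops b -> a = b.
Proof.
by case: a b => [A hA] [B hB] /= E; subst; rewrite (Prop_irrelevance hA hB).
Qed.

Lemma pi1_eqP a b p q : loops a p -> loops b q -> homotopic x x p q -> a = b.
Proof.
case: a b => [A [p' hp' EA]] [B [q' hq' EB]] /= Ap Bq h.
apply: pi1_ext; rewrite /= EA EB; rewrite EA in Ap; rewrite EB in Bq.
have {Ap Bq h p q} H : homotopic x x p' q'.
  by apply: (rst_trans _ _ _ _ _ Ap); apply: (rst_trans _ _ _ _ _ h); apply: rst_sym.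
apply/seteqP; split=> r hr.
- by apply: rst_trans (rst_sym _ _ _ _ H) hr.
- by apply: rst_trans H hr.
Qed.

Definition pi1_one : pi1 x := @pi1_class [::] erefl.

Fact pi1_mul_subproof a b : epath x (rep a ++ rep b) x.
Proof. by apply/epath_cat; exists x; apply: rep_epath. Qed.

Definition pi1_mul a b : pi1 x := pi1_class (pi1_mul_subproof a b).

Definition pi1_inv a : pi1 x := pi1_class (epath_prev (rep_epath a)).

Lemma loops_class p (hp : epath x p x) q :
  loops (pi1_class hp) q -> homotopic x x q p.
Proof. by move=> h; apply: rst_sym. Qed.

Lemma loops_refl p (hp : epath x p x) : loops (pi1_class hp) p.
Proof. exact: rst_refl. Qed.

Lemma pi1_mulA : associative pi1_mul.
Proof.
move=> a b c.
apply: (pi1_eqP (loops_refl _) (loops_refl _)).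
apply: (rst_trans _ _ _ (rep a ++ (rep b ++ rep c))).
  apply: homotopic_cat; try exact: rep_epath; first exact: rst_refl.
  exact: (loops_class (loops_rep (pi1_mul b c))).
rewrite catA; apply: homotopic_cat; try exact: rep_epath; last exact: rst_refl.
  by apply/epath_cat; exists x; apply: rep_epath.
exact: (loops_rep (pi1_mul a b)).
Qed.

Lemma pi1_mul1g : left_id pi1_one pi1_mul.
Proof.
move=> a; apply: (pi1_eqP (loops_refl _) (loops_rep a)).
rewrite -[rep a in X in homotopic _ _ _ X]cat0s.
apply: homotopic_cat; try exact: rep_epath; last exact: rst_refl.
exact: (loops_class (loops_rep pi1_one)).
Qed.

Lemma pi1_mulg1 : right_id pi1_one pi1_mul.
Proof.
move=> a; apply: (pi1_eqP (loops_refl _) (loops_rep a)).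
rewrite -[rep a in X in homotopic _ _ _ X]cats0.
apply: homotopic_cat; try exact: rep_epath; first exact: rst_refl.
exact: (loops_class (loops_rep pi1_one)).
Qed.

Lemma prevK : involutive (@prev X).
Proof.
move=> p; rewrite /prev map_rev revK -map_comp -[RHS]map_id.
by apply: eq_map => e /=; rewrite erevK.
Qed.

Lemma pi1_mulgV : right_inverse pi1_one pi1_inv pi1_mul.
Proof.
move=> a; apply: (pi1_eqP (loops_refl _) (loops_refl _)).
apply: rst_trans (homotopic_prev (rep_epath a)).
apply: homotopic_cat; try exact: rep_epath; first exact: rst_refl.
exact: (loops_class (loops_rep (pi1_inv a))).
Qed.

Lemma pi1_mulVg : left_inverse pi1_one pi1_inv pi1_mul.
Proof.
move=> a; apply: (pi1_eqP (loops_refl _) (loops_refl _)).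
have := homotopic_prev (epath_prev (rep_epath a)); rewrite prevK.
apply: rst_trans.
apply: homotopic_cat; try exact: rep_epath; last exact: rst_refl.
exact: (loops_class (loops_rep (pi1_inv a))).
Qed.

HB.instance Definition _ := isGroup.Build (pi1 x)
  pi1_mulA pi1_mul1g pi1_mulg1 pi1_mulVg pi1_mulgV.

End Pi1.

Record cube_map (Y X : cube_complex) := CubeMap {
  cmap :> forall n, Y n -> X n;
  cmap_restr : forall m n (f : face m n) (c : Y n),
    cmap (restr f c) = restr f (cmap c) }.

Section Maps.
Variables (Y X : cube_complex) (phi : cube_map Y X).

(* Two parametrized cubes with the same origin and the same image coincide,
   i.e. phi is injective on the corners of cubes at each 0-cube. *)
Definition locally_injective : Prop :=
  forall n (c c' : Y n), origin c = origin c' -> phi n c = phi n c' -> c = c'.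

Definition local_isometry : Prop :=
  locally_injective /\
  forall (y : Y 0) n (e : 'I_n -> Y 1) (c : X n),
    (forall i, src (e i) = y) ->
    origin c = phi 0 y ->
    (forall i, phi 1 (e i) = corner_edge c i) ->
    exists c' : Y n,
      [/\ origin c' = y, (forall i, corner_edge c' i = e i) & phi n c' = c].

Definition covering : Prop :=
  forall (y : Y 0) n (c : X n), origin c = phi 0 y ->
    exists! c' : Y n, origin c' = y /\ phi n c' = c.

Definition universal_covering : Prop :=
  [/\ covering, connected Y & forall (y : Y 0) (a : pi1 y), a = 1%g].

End Maps.

Record simplicial_graph := SimplicialGraph {
  gvert : Type;
  adj : gvert -> gvert -> Prop;
  adj_sym : forall v w, adj v w -> adj w v;
  adj_irr : forall v, ~ adj v v }.

(* An n-cube of the Salvetti complex, parametrized: an n-clique, enumerated by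
   the axes of [0,1]^n, with for each axis a bit telling whether the axis runs
   against the orientation of the 1-cube labeled by the vertex. *)
Record salvetti_cube (Gamma : simplicial_graph) (n : nat) := SalvettiCube {
  slab : {ffun 'I_n -> gvert Gamma * bool};
  _ : forall i j, i != j -> adj (slab i).1 (slab j).1 }.

Section Salvetti.
Variable Gamma : simplicial_graph.

Lemma slab_adj n (c : salvetti_cube Gamma n) i j :
  i != j -> adj (slab c i).1 (slab c j).1.
Proof. by case: c => l h; exact: h. Qed.

Lemma slab_eq n (c c' : salvetti_cube Gamma n) : slab c =1 slab c' -> c = c'.
Proof.
case: c c' => [l h] [l' h'] /= /ffunP E; subst.
by rewrite (Prop_irrelevance h h').
Qed.

Definition srestr_fun m n (f : face m n) (c : salvetti_cube Gamma n) :=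
  [ffun i => ((slab c (fdir f i)).1,
              (slab c (fdir f i)).2 (+) fbase f (fdir f i))].

Fact srestr_subproof m n (f : face m n) (c : salvetti_cube Gamma n) i j :
  i != j -> adj (srestr_fun f c i).1 (srestr_fun f c j).1.
Proof.
by move=> ij; rewrite !ffunE /=; apply: slab_adj; rewrite (inj_eq (@fdir_inj _ _ f)).
Qed.

Definition srestr m n (f : face m n) (c : salvetti_cube Gamma n) :
  salvetti_cube Gamma m := SalvettiCube (@srestr_subproof m n f c).

Fact srestr_id n (c : salvetti_cube Gamma n) : srestr (face_id n) c = c.
Proof. by apply: slab_eq => i; rewrite /= !ffunE addbF; case: (slab c i). Qed.

Fact srestr_comp m n p (g : face n p) (f : face m n)
  (c : salvetti_cube Gamma p) :
  srestr (face_comp g f) c = srestr f (srestr g c).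
Proof.
apply: slab_eq => i; rewrite /= !ffunE /= -addbA; congr (_, _ (+) (_ (+) _)).
apply/existsP/idP => [[j /andP[/eqP /fdir_inj ->]] //|h].
by exists (fdir f i); rewrite eqxx.
Qed.

Fact srestr_free n (f : face n n) (c : salvetti_cube Gamma n) :
  srestr f c = c -> f = face_id n.
Proof.
move=> E; have {}E i : srestr_fun f c i = slab c i by rewrite -[in RHS]E.
have Ed i : fdir f i = i.
  apply/eqP; apply: contrapT => /negP /(slab_adj c).
  by move: (E i); rewrite ffunE => <- /=; apply: adj_irr.
have Eb i : fbase f i = false.
  move: (E i); rewrite ffunE Ed; case: (slab c i) => v b [].
  by case: b (fbase f i) => [] [].
case: f Ed Eb {E} => d b h /= Ed Eb.
have Hd : d = [ffun i => i] by apply/ffunP => i; rewrite ffunE Ed.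
have Hb : b = [ffun=> false] by apply/ffunP => i; rewrite ffunE Eb.
by subst; rewrite /face_id; congr Face; apply: bool_irrelevance.
Qed.

Definition salvetti : cube_complex :=
  CubeComplex srestr_id srestr_comp srestr_free.

End Salvetti.

Definition special (X : cube_complex) : Prop :=
  connected X /\
  exists (Gamma : simplicial_graph) (phi : cube_map X (salvetti Gamma)),
    local_isometry phi.

Section Convexity.
Variable Y : cube_complex.

Definition subcomplex (A : forall n, set (Y n)) : Prop :=
  forall m n (f : face m n) (c : Y n), A n c -> A m (restr f c).

Definition full (A : forall n, set (Y n)) : Prop :=
  forall n (c : Y n),
    (forall k (f : face k n), k <= 1 -> A k (restr f c)) -> A n c.

Definition convex (A : forall n, set (Y n)) : Prop :=
  [/\ subcomplex A, full A &
      forall u v p, A 0 u -> A 0 v -> geodesic u p v -> List.Forall (A 1) p].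

Definition convex_hull (B : set (Y 0)) (n : nat) : set (Y n) :=
  [set c | forall A, convex A -> B `<=` A 0 -> A n c].

Definition neighborhood (K : nat) (B : set (Y 0)) : set (Y 0) :=
  [set v | exists2 u, B u & ele (dist v u) (Some K)].

(* The number of 0-cubes at distance at most K from y.  Only used when Y is
   locally finite, so that this number is finite. *)
Definition growth (y : Y 0) (K : nat) : nat :=
  odflt 0 (ecard [set v | ele (dist y v) (Some K)]).

End Convexity.

Arguments convex_hull {Y} B n _.

Section Classes.
Variables (X : cube_complex) (x : X 0) (G : groupType) (iota : G -> pi1 x).

Definition represented (R : nat) (Q : set G) : Prop :=
  exists (Z : cube_complex) (z : Z 0) (phi : cube_map Z X),
    [/\ compact Z, connected Z, ele (ecard [set: Z 0]) (Some R),
        local_isometry phi /\ phi 0 z = x &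
        Q = [set g | exists2 p, epath z p z & loops (iota g) (map (phi 1) p)]].

Variables (Xt : cube_complex) (cov : cube_map Xt X) (xt : Xt 0).

Definition deck_transformation (t : cube_map Xt Xt) : Prop :=
  (forall n, bijective (t n)) /\ forall n (c : Xt n), cov n (t n c) = cov n c.

(* The deck transformation t is the action of g: t maps xt to the endpoint of
   the lift at xt of the loops in the class of g. *)
Definition acts_as (g : G) (t : cube_map Xt Xt) : Prop :=
  deck_transformation t /\
  exists2 p, epath xt p (t 0 xt) & loops (iota g) (map (cov 1) p).

Definition orbit (Q : set G) : set (Xt 0) :=
  [set v | exists g t, [/\ Q g, acts_as g t & v = t 0 xt]].

Definition hull_near_orbit (K : nat) (Q : set G) : Prop :=
  subgroup Q /\ convex_hull (orbit Q) 0 `<=` neighborhood K (orbit Q).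

End Classes.

(* Main.v *)
Require Import Defs.
From Stdlib Require Import Relations.
From Stdlib Require Eqdep_dec PeanoNat.
From mathcomp Require Import all_boot.
From mathcomp Require Import boolp classical_sets functions cardinality.

(** Label every oriented edge of the special complex X by its image in the
    Salvetti complex: a vertex of the graph Gamma with a sign.  Let T be a
    finite set with partial injections, one per letter, such that opposite
    letters are inverse to each other and two moves along adjacent letters
    close up to a square (a [folded] labelled graph); the vertices of a complex
    with a local isometry to the Salvetti complex are the basic example.  Each
    partial injection extends to a permutation of T by sending the end of a
    line back to its beginning.  Squares make these permutations commute for
    adjacent letters ([completionP]), so paths of X act on T, homotopic paths
    act in the same way, and the stabilizer of a point is a subgroup of G of
    index at most the cardinal of T.

    To separate g from Q, let T be a labelled graph with a base point t at
    which exactly the loops representing elements of Q close up.  Take a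
    shortest loop p representing g.  Its label word is reduced, because a letter
    could otherwise be slid across squares until it meets its inverse
    ([shortest_reduced]).  Follow this word in T from t.  If it can be read
    entirely, it ends away from t.  Otherwise it stops at a first letter v, and
    T is enlarged as follows.  Extract from the rest of the word a chain
    v = v_1, v_2, ..., v_k, where v_(i+1) is the first letter after v_i that is
    not adjacent to v_i, and stack k copies of T above T, joining level i-1 to
    level i by edges labelled v_i above the points that have no v-edge.  Level i
    keeps only the edges whose letter is adjacent to all of v_1, ..., v_i.  This
    [tower] is again folded.  In its completion, the word climbs one level at
    each letter of the chain, and between two of these it stays on its level,
    since it reads letters adjacent to v_i ([run_climb]).  It therefore ends at
    level k > 0, not at t, and the stabilizer of t contains Q but not g.  The
    index is at most #|T| times 1 plus the length of p, which is linear in the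
    word length of g ([Sep_le]).

    If Q is represented by a local isometry from Z, then T is the vertex set
    of Z.  If the hull of the orbit of Q stays K-close to it, then T is the
    quotient of the vertices of the hull by Q, which embeds in the ball of
    radius K ([hull_classes]).  It is folded because the fourth corner of a
    square lies on a geodesic between two opposite corners
    ([corner_geodesic]), so that squares do not leave the hull.  Q acts on the
    hull because every element of the fundamental group acts on the universal
    cover, which is obtained by lifting paths ([translation]). *)

Set Implicit Arguments.
Unset Strict Implicit.
Unset Printing Implicit Defensive.

(** * Labelled graphs and their completion to commuting permutations *)

Lemma onth_drop0 (T : Type) (s : seq T) n : onth s n = onth (drop n s) 0.
Proof. by elim: s n => [|x s IH] [|n] //=; rewrite IH. Qed.

Section LabelledGraphs.
Variables (L : Type) (inv : L -> L) (lk : rel L).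
Hypothesis invK : involutive inv.
Hypothesis lk_sym : symmetric lk.
Hypothesis lk_inv : forall a b, lk a b -> lk (inv a) b.
Hypothesis lk_irr : forall a, ~~ lk a a.

Let lk_invr a b : lk a b -> lk a (inv b).
Proof. by rewrite ![lk a _]lk_sym; apply: lk_inv. Qed.

(** The edge relation of a graph whose oriented edges carry letters, such that
    each letter acts by a partial injection: the combinatorial content of a
    local isometry to the Salvetti complex.  A relation is used rather than a
    partial function so that [folded_inv] treats an edge and its reverse
    alike. *)
Record folded (T : Type) (E : L -> T -> T -> Prop) : Prop := Folded {
  folded_inv : forall a s t, E a s t -> E (inv a) t s;
  folded_det : forall a s t u, E a s t -> E a s u -> t = u;
  folded_square : forall a b s t u, lk a b -> E a s t -> E b s u ->
    exists2 w, E b t w & E a u w }.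

(** Total extensions of the partial injections.  The last clause records that
    an extension never leaves a union of lines: it is all that is needed about
    the points where a partial injection is undefined. *)
Record completes (T : Type) (E : L -> T -> T -> Prop) (rho : L -> T -> T) :
    Prop := Completes {
  completes_cancel : forall a, cancel (rho a) (rho (inv a));
  completes_comm : forall a b s, lk a b -> rho b (rho a s) = rho a (rho b s);
  completes_edge : forall a s t, E a s t -> rho a s = t;
  completes_stable : forall (B : T -> Prop) a,
    (forall s t, B s -> E a s t -> B t) ->
    (forall s t, B s -> E (inv a) s t -> B t) ->
    forall s, B s -> B (rho a s) }.

Fixpoint follows (T : Type) (E : L -> T -> T -> Prop) s w t : Prop :=
  if w is a :: w' then exists2 u, E a s u & follows E u w' t else s = t.

Definition run (T : Type) (rho : L -> T -> T) (s : T) (w : seq L) : T :=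
  foldl (fun u a => rho a u) s w.

Section Completion.
Variables (T : finType) (E : L -> T -> T -> Prop).
Hypothesis E_folded : folded E.

Let live a s := exists t, E a s t.

Let next a s : T := if [pick t | `[< E a s t >]] is Some t then t else s.

(** At the end of an a-line, go back along the line to its beginning.  A line
    has at most #|T| points, and [next] is the identity beyond its end. *)
Definition completion a s : T :=
  if `[< live a s >] then next a s else iter #|T| (next (inv a)) s.

Let next_edge a s t : E a s t -> next a s = t.
Proof.
move=> st; rewrite /next; case: pickP => [u /asboolP su|/(_ t)/asboolP //].
exact: folded_det su st.
Qed.

Let next_dead a s : ~ live a s -> next a s = s.
Proof.
move=> ds; rewrite /next; case: pickP => // u /asboolP su.
by case: ds; exists u.
Qed.

Let iter_next_dead a s n : ~ live a s -> iter n (next a) s = s.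
Proof. by move=> ds; elim: n => //= n ->; apply: next_dead. Qed.

(** Otherwise the backward walk has more than #|T| steps, so that it meets
    itself, and by injectivity it comes back to its starting point s; but then
    an a-edge leaves s. *)
Let end_dead a s :
  ~ live a s -> ~ live (inv a) (iter #|T| (next (inv a)) s).
Proof.
set b := inv a => ds; set N := #|T|.
case: (pselect (exists2 i, i <= N & ~ live b (iter i (next b) s))).
  move=> [i iN di]; rewrite -(subnK iN) iterD iter_next_dead //.
move=> noend _.
have alive i : i <= N -> live b (iter i (next b) s).
  by move=> iN; apply: contrapT => di; apply: noend; exists i.
have back i : i <= N -> E a (iter i.+1 (next b) s) (iter i (next b) s).
  move=> /alive[t st]; rewrite iterS (next_edge st) -[a]invK.
  exact: folded_inv st.
have inj i j : i <= N -> j <= N ->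
    iter i (next b) s = iter j (next b) s -> i = j.
  elim: i j => [|i IH] [|j] iN jN // ij.
  - by case: ds; exists (iter j (next b) s); rewrite [s in E _ s]ij; apply/back/ltnW.
  - by case: ds; exists (iter i (next b) s); rewrite [s in E _ s]/= -[s in E _ s]ij; apply/back/ltnW.
  - congr S; apply: IH; rewrite ?(ltnW iN) ?(ltnW jN) //.
    apply: (folded_det E_folded) (back _ (ltnW iN)) _.
    by rewrite ij; apply: back; apply: ltnW.
have : injective (fun i : 'I_N.+1 => iter i (next b) s).
  by move=> i j ij; apply: val_inj; exact: inj (ltn_ord i) (ltn_ord j) ij.
by move=> /leq_card; rewrite card_ord ltnn.
Qed.

Let retrace a s n :
  exists2 m, m <= n & iter m (next a) (iter n (next (inv a)) s) = s.
Proof.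
elim: n => [|n [m mn IH]]; first by exists 0.
rewrite iterS; set u := iter n _ s in IH *.
case: (pselect (live (inv a) u)) => [[t ut]|du].
  exists m.+1 => //; rewrite iterSr (next_edge ut) (@next_edge a t u) //.
  by rewrite -[a]invK; apply: folded_inv ut.
by exists m; [exact: leqW | rewrite next_dead].
Qed.

Let completion_edge a s t : E a s t -> completion a s = t.
Proof.
move=> st; rewrite /completion asboolT; first exact: next_edge.
by exists t.
Qed.

Let completion_dead a s :
  ~ live a s -> completion a s = iter #|T| (next (inv a)) s.
Proof. by move=> ds; rewrite /completion asboolF. Qed.

Let completion_cancel a : cancel (completion a) (completion (inv a)).
Proof.
move=> s; case: (pselect (live a s)) => [[t st]|ds].
  rewrite (completion_edge st); apply: completion_edge.
  exact: folded_inv st.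
rewrite (completion_dead ds) completion_dead; last exact: end_dead.
have [m mN ms] := retrace a s #|T|.
by rewrite invK -(subnK mN) iterD subnK // ms iter_next_dead.
Qed.

Let completion_stable (B : T -> Prop) a :
    (forall s t, B s -> E a s t -> B t) ->
    (forall s t, B s -> E (inv a) s t -> B t) ->
  forall s, B s -> B (completion a s).
Proof.
move=> Ba Bi s Bs; case: (pselect (live a s)) => [[t st]|ds].
  by rewrite (completion_edge st); apply: Ba st.
rewrite completion_dead //; elim: #|T| => //= n Bn.
set u := iter n _ s in Bn *; case: (pselect (live (inv a) u)) => [[t ut]|du].
  by rewrite (next_edge ut); apply: Bi ut.
by rewrite next_dead.
Qed.

(** The squares along an a-edge from s to t map the b-line through s
    isomorphically to the b-line through t, ends included. *)
Let completion_parallel a b s t :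
  lk a b -> E a s t -> E a (completion b s) (completion b t).
Proof.
move=> ab st.
have dead c : lk a c -> ~ live c s -> ~ live c t.
  move=> ac ds [w tw]; apply: ds.
  have [v sv _] := folded_square E_folded (lk_inv ac) (folded_inv E_folded st) tw.
  by exists v.
case: (pselect (live b s)) => [[u su]|ds].
  have [w tw uw] := folded_square E_folded ab st su.
  by rewrite (completion_edge su) (completion_edge tw).
rewrite !completion_dead //; last exact: dead ds.
elim: #|T| => //= n; set s' := iter n _ s; set t' := iter n _ t => st'.
case: (pselect (live (inv b) s')) => [[u su]|ds'].
  have [w tw uw] := folded_square E_folded (lk_invr ab) st' su.
  by rewrite (next_edge su) (next_edge tw).
rewrite !next_dead // => -[w tw]; apply: ds'.
have [v sv _] := folded_square E_folded (lk_inv (lk_invr ab))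
  (folded_inv E_folded st') tw.
by exists v.
Qed.

(** By [completion_parallel], the permutation attached to b is an automorphism
    of the partial injection attached to a, and the completion is defined from
    the latter alone. *)
Let completion_comm a b s :
  lk a b -> completion b (completion a s) = completion a (completion b s).
Proof.
move=> ab.
have dead c u : lk c b -> ~ live c u -> ~ live c (completion b u).
  move=> cb du [w uw]; apply: du.
  exists (completion (inv b) w); rewrite -[u in E c u](completion_cancel b).
  exact: completion_parallel (lk_invr cb) uw.
have nextP c u : lk c b -> completion b (next c u) = next c (completion b u).
  move=> cb; case: (pselect (live c u)) => [[t ut]|du].
    by rewrite (next_edge ut) (next_edge (completion_parallel cb ut)).
  by rewrite !next_dead //; exact: (dead _ _ cb du).
case: (pselect (live a s)) => [[t st]|ds].
  rewrite (completion_edge st).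
  by rewrite (completion_edge (completion_parallel ab st)).
rewrite (completion_dead ds) (completion_dead (dead _ _ ab ds)).
by elim: #|T| => //= n <-; rewrite nextP //; apply: lk_inv.
Qed.

Lemma completionP : completes E completion.
Proof.
split; [exact: completion_cancel | | exact: completion_edge
       | exact: completion_stable].
by move=> a b s ab; apply: completion_comm.
Qed.

End Completion.

Section Runs.
Variables (T : Type) (E : L -> T -> T -> Prop) (rho : L -> T -> T).
Hypothesis rhoP : completes E rho.

Lemma run_follows s w t : follows E s w t -> run rho s w = t.
Proof.
by elim: w s => [|a w IH] s //= [u su /IH]; rewrite (completes_edge rhoP su).
Qed.

End Runs.

Section Tower.

(** No letter can be moved next to its inverse by commuting adjacent letters:
    this is the usual notion for words in right-angled Artin groups. *)
Definition reduced (w : seq L) : Prop :=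
  forall w1 a m w2, w = w1 ++ a :: m ++ inv a :: w2 -> ~~ all (lk a) m.

Lemma reduced_suffix w1 w2 : reduced (w1 ++ w2) -> reduced w2.
Proof.
move=> red v1 a m v2 E; apply: (red (w1 ++ v1) a m v2).
by rewrite E catA.
Qed.

(** Each letter of the chain is the first one, after its predecessor, which does
    not commute with this predecessor (equal letters do not count as
    commuting). *)
Fixpoint chain (v : L) (w : seq L) : seq L :=
  if w is a :: w' then if lk v a then chain v w' else a :: chain a w' else [::].

Lemma size_chain v w : size (chain v w) <= size w.
Proof.
elim: w v => //= a w IH v; case: ifP => _ /=; last by rewrite ltnS.
exact: leqW.
Qed.

Definition climbing (vs : seq L) : Prop :=
  forall i a b, onth vs i = Some a -> onth vs i.+1 = Some b ->
    ~~ lk a b /\ b <> inv a.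

(** If the chain contained a letter followed by its inverse, the letters
    of w between the two would all commute with them, and v :: w would not be
    reduced. *)
Lemma chain_climbing v w : reduced (v :: w) -> climbing (v :: chain v w).
Proof.
(* Here m stands for the letters skipped since v was put into the chain. *)
suff gen m : all (lk v) m -> reduced (v :: m ++ w) ->
  climbing (v :: chain v w) by exact: (gen [::]).
elim: w v m => [|a w IH] v m vm red /=.
  by move=> [|i] c d //=; rewrite onth0n.
case: ifP => va.
  by apply: (IH v (rcons m a)); rewrite ?all_rcons ?va // cat_rcons.
have redw : climbing (a :: chain a w).
  apply: (IH a [::]) => //.
  by apply: (@reduced_suffix (v :: m)); rewrite cat_cons.
move=> [|i] c d /=; last exact: redw.
case=> <- [<-]; split; first by rewrite va.
by move=> E; have := red [::] v m w; rewrite -E => /(_ erefl); rewrite vm.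
Qed.

Variables (T : Type) (E : L -> T -> T -> Prop).
Hypothesis E_folded : folded E.
Variables (v : L) (vs : seq L).
Hypothesis vs_climb : climbing (v :: vs).

Let k := size (v :: vs).
Let C c := forall t, ~ E v c t.
Implicit Types s t u : T * 'I_k.+1.

(** The i-th letter of v :: vs (counted from 0) labels the edges from level i
    to level i+1, over the points where v is undefined. *)
Definition ascent a s t : Prop :=
  [/\ onth (v :: vs) s.2 = Some a, t.2 = s.2.+1 :> nat, s.1 = t.1 & C s.1].

Definition level_edge a s t : Prop :=
  [/\ s.2 = t.2, E a s.1 t.1 &
      s.2 = 0 :> nat \/ C s.1 /\ all (lk a) (take s.2 (v :: vs))].

Definition tower a s t : Prop :=
  [\/ level_edge a s t, ascent a s t | ascent (inv a) t s].

(** The set C is a union of components for the letters adjacent to v, because a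
    v-edge propagates along such a letter by squares. *)
Let C_edge a c c' : lk a v -> E a c c' -> C c -> C c'.
Proof.
move=> av cc' Cc t vt.
have [w cw _] := folded_square E_folded (lk_inv av) (folded_inv E_folded cc') vt.
exact: Cc cw.
Qed.

Let link_head a i : all (lk a) (take i.+1 (v :: vs)) -> lk a v.
Proof. by case/andP. Qed.

Let link_onth a i b :
  all (lk a) (take i.+1 (v :: vs)) -> onth (v :: vs) i = Some b -> lk a b.
Proof.
elim: i (v :: vs) => [|i IH] [|c l] //=; first by rewrite take0 andbT => + [<-].
by case/andP=> _; apply: IH.
Qed.

Let link_take a i b : onth (v :: vs) i = Some b ->
  all (lk a) (take i.+1 (v :: vs)) = all (lk a) (take i (v :: vs)) && lk a b.
Proof.
elim: i (v :: vs) => [|i IH] [|c l] //=; first by case=> <-; rewrite take0 andbT.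
by move=> /IH ->; rewrite andbA.
Qed.

Let tower_inv a s t : tower a s t -> tower (inv a) t s.
Proof.
case=> [[lev e int]|up|up]; [|by apply: Or33; rewrite invK|exact: Or32].
apply: Or31; split; [by []|exact: folded_inv e|].
rewrite -lev; case: int => [->|[Cs al]]; [by left|].
case E0: (s.2 : nat) al => [|i] al; [by left|right; split].
  exact: C_edge (link_head al) e Cs.
by apply: sub_all al => b; apply: lk_inv.
Qed.

Let eq_vertex s t : s.1 = t.1 -> s.2 = t.2 :> nat -> s = t.
Proof. by case: s t => [s i] [t j] /= -> /val_inj ->. Qed.

(** On level 0, ascending edges start at points without v-edge; on level i+1,
    the next letter of the chain is not adjacent to the previous one, whereas
    the letters of level edges are. *)
Let level_ascent a s t u : level_edge a s t -> ~ ascent a s u.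
Proof.
move=> [_ e int] [ons _ _ Cs]; case E0: (s.2 : nat) int ons => [|i] int ons.
  by case: ons => E1; subst a; case: (Cs _ e).
case: int => // -[_ al]; have lti : i < size (v :: vs).
  by apply: ltnW; rewrite -onthTE ons.
case onc: (onth (v :: vs) i) => [c|]; last by move: lti; rewrite -onthTE onc.
have [/negP ca _] := vs_climb onc ons; apply: ca.
by rewrite lk_sym; apply: link_onth al onc.
Qed.

Let level_descent a b s t u : level_edge a s t -> ascent b u s -> lk a b.
Proof.
move=> [_ _ int] [onu su _ _]; case: int; rewrite su // => -[_ al].
exact: link_onth al onu.
Qed.

Let ascent_descent a b s t u :
  ascent a s t -> ascent b u s -> ~~ lk b a /\ a <> inv b.
Proof.
move=> [ons _ _ _] [onu su _ _]; rewrite su in ons.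
exact: vs_climb onu ons.
Qed.

Let not_lk_inv a : lk a (inv a) -> False.
Proof. by move/lk_invr; rewrite invK (negPf (lk_irr a)). Qed.

Let tower_det a s t u : tower a s t -> tower a s u -> t = u.
Proof.
case=> [st|st|ts] [su|su|us].
- case: st su => [lt et _] [lu eu _]; apply: eq_vertex; last by rewrite -lt lu.
  exact: folded_det et eu.
- by case: (level_ascent st su).
- by case: (@not_lk_inv a); exact: level_descent st us.
- by case: (level_ascent su st).
- by case: st su => [_ lt et _] [_ lu eu _]; apply: eq_vertex; rewrite -?et ?lt ?lu.
- by have [_] := ascent_descent st us; rewrite invK.
- by case: (@not_lk_inv a); exact: level_descent su ts.
- by have [_] := ascent_descent su ts; rewrite invK.
- case: ts us => [_ lt et _] [_ lu eu _]; apply: eq_vertex; first by rewrite et eu.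
  by apply: succn_inj; rewrite -lt -lu.
Qed.

Let level_square a b s t u : lk a b -> level_edge a s t -> level_edge b s u ->
  exists2 w, level_edge b t w & level_edge a u w.
Proof.
move=> ab [lt et it] [lu eu iu].
have [w tw uw] := folded_square E_folded ab et eu.
exists (w, s.2); split=> //=; rewrite -?lt -?lu //.
- case: iu => [|[Cs al]]; [by left|];
  case E0: (s.2 : nat) it al => [|i] it al; [by left|].
  right; split=> //; case: it => // -[_ al']; exact: C_edge (link_head al') et Cs.
- case: it => [|[Cs al]]; [by left|];
  case E0: (s.2 : nat) iu al => [|i] iu al; [by left|].
  right; split=> //; case: iu => // -[_ al']; exact: C_edge (link_head al') eu Cs.
Qed.

(** On level 0 as on the other ones, the letter b is adjacent to v: on level 0
    because a is then v itself. *)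
Let ascent_square a b s t u : lk a b -> ascent a s t -> level_edge b s u ->
  exists2 w, level_edge b t w & ascent a u w.
Proof.
move=> ab [ons ts est Cs] [lu eu iu].
have bv : lk b v.
  case E0: (s.2 : nat) iu ons => [|i] iu; first by case=> ->; rewrite lk_sym.
  by case: iu => // -[_ /link_head].
have Cu : C u.1 by exact: C_edge bv eu Cs.
exists (u.1, t.2); last by split=> //=; rewrite -lu.
split=> //=; first by rewrite -est.
right; split; first by rewrite -est.
rewrite ts (link_take _ ons) [lk b a]lk_sym ab andbT.
by case: iu => [->|[]].
Qed.

Let descent_square a b s t u : lk a b -> ascent a t s -> level_edge b s u ->
  exists2 w, level_edge b t w & ascent a w u.
Proof.
move=> ab [ont st ets Ct] [lu eu iu].
case: iu; rewrite st // => -[Cs al].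
move: (al); rewrite (link_take _ ont) => /andP[al' _].
exists (u.1, t.2); first by split=> //=; rewrite ?ets //; right.
split=> //=; first by rewrite -lu.
exact: C_edge (link_head al) eu Cs.
Qed.

(** Two adjacent letters never label a pair of vertical edges: the letters of
    consecutive steps are not adjacent, by [ascent_descent].  So each square has
    a pair of parallel level edges. *)
Lemma tower_folded : folded tower.
Proof.
split; [exact: tower_inv|exact: tower_det|].
move=> a b s t u ab; have ba : lk b a by rewrite lk_sym.
case=> [st|st|ts] [su|su|us].
- have [w tw uw] := level_square ab st su.
  by exists w; [exact: Or31|exact: Or31].
- have [w tw uw] := ascent_square ba su st.
  by exists w; [exact: Or32|exact: Or31].
- have [w tw uw] := descent_square (lk_inv ba) us st.
  by exists w; [exact: Or33|exact: Or31].
- have [w tw uw] := ascent_square ab st su.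
  by exists w; [exact: Or31|exact: Or32].
- case: st su => [ons _ _ _] [ons' _ _ _]; move: ons'; rewrite ons => -[E'].
  by move: ab; rewrite -E' (negPf (lk_irr a)).
- have [/negP[]] := ascent_descent st us; exact: lk_inv.
- have [w tw uw] := descent_square (lk_inv ab) ts su.
  by exists w; [exact: Or31|exact: Or33].
- have [/negP[]] := ascent_descent su ts; exact: lk_inv.
- case: ts us => [ont lt _ _] [onu lu _ _]; move: onu.
  have -> : (u.2 : nat) = t.2 by apply: succn_inj; rewrite -lt -lu.
  rewrite ont => -[/(can_inj invK) E'].
  by move: ab; rewrite -E' (negPf (lk_irr a)).
Qed.

Variable rho : L -> T * 'I_k.+1 -> T * 'I_k.+1.
Hypothesis rhoP : completes tower rho.

Lemma follows_tower x w y :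
  follows E x w y -> follows tower (x, ord0) w (y, ord0).
Proof.
elim: w x => [|a w IH] x /=; first by move=> ->.
move=> [z xz zy]; exists (z, ord0); last exact: IH.
by apply: Or31; split=> //; left.
Qed.

(** A letter adjacent to c labels neither the ascending nor the descending edges
    at level i+1, so a whole line of this letter stays on the level. *)
Let level_stable i c a s : onth (v :: vs) i = Some c -> lk c a ->
  s.2 = i.+1 :> nat -> C s.1 -> (rho a s).2 = i.+1 :> nat /\ C (rho a s).1.
Proof.
move=> oni ca si Cs.
have stays d u t : lk c d -> u.2 = i.+1 :> nat /\ C u.1 -> tower d u t ->
    t.2 = i.+1 :> nat /\ C t.1.
  move=> cd [ui Cu] [[lt e int]|[onu _ _ _]|[ont ut _ _]].
  - split; first by rewrite -lt.
    by case: int => [|[_]]; rewrite ui // => /link_head dv; apply: C_edge e Cu.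
  - by rewrite ui in onu; have [/negP[]] := vs_climb oni onu.
  - case: (@not_lk_inv d); move: ut ont; rewrite ui => -[<-].
    by rewrite oni => -[<-]; rewrite lk_sym.
apply: (completes_stable rhoP (B := fun u => u.2 = i.+1 :> nat /\ C u.1)) => //.
  by move=> u t; exact: stays.
by move=> u t; apply: stays; exact: lk_invr.
Qed.

(** Here c is the letter of the chain by which level i+1 was entered, and w is
    the rest of the word. *)
Lemma run_climb w c i s :
    onth (v :: vs) i = Some c -> drop i.+1 (v :: vs) = chain c w ->
    s.2 = i.+1 :> nat -> C s.1 ->
  (run rho s w).2 = k :> nat.
Proof.
elim: w c i s => [|a w IH] c i s oni drp si Cs.
  rewrite [run _ _ _]/=; apply/eqP; rewrite eqn_leq -ltnS ltn_ord /= si.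
  by rewrite -subn_eq0 -size_drop drp.
rewrite [run _ _ _]/=; move: drp; rewrite [chain _ _]/=; case: ifP => ca drp.
  have [ri Cr] := level_stable oni ca si Cs; exact: IH oni drp ri Cr.
have ona : onth (v :: vs) i.+1 = Some a.
  by rewrite onth_drop0 drp.
have drp' : drop i.+2 (v :: vs) = chain a w.
  by rewrite -[i.+2]addn1 addnC -drop_drop drp /= drop0.
have lti : i.+2 < k.+1 by rewrite ltnS -onthTE ona.
have up : tower a s (s.1, Ordinal lti).
  by apply: Or32; split=> //=; rewrite si.
rewrite (completes_edge rhoP up); exact: (IH _ _ (s.1, Ordinal lti) ona drp').
Qed.

End Tower.

Lemma run_cat (T : Type) (rho : L -> T -> T) s w1 w2 :
  run rho s (w1 ++ w2) = run rho (run rho s w1) w2.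
Proof. exact: foldl_cat. Qed.

Lemma follows_or_stops (T : Type) (E : L -> T -> T -> Prop) s w :
  (exists t, follows E s w t) \/
  exists w1 a w2 c,
    [/\ w = w1 ++ a :: w2, follows E s w1 c & forall t, ~ E a c t].
Proof.
elim: w s => [|a w IH] s; first by left; exists s.
case: (pselect (exists u, E a s u)) => [[u su]|ns]; last first.
  by right; exists [::], a, w, s; split=> // t st; apply: ns; exists t.
case: (IH u) => [[t ut]|[w1 [b [w2 [c [-> uc stop]]]]]].
  by left; exists t, u.
by right; exists (a :: w1), b, w2, c; split=> //; exists u.
Qed.

Definition commuting (T : Type) (rho : L -> T -> T) : Prop :=
  (forall a, cancel (rho a) (rho (inv a))) /\
  forall a b s, lk a b -> rho b (rho a s) = rho a (rho b s).

(** The completion of T itself is enough if w can be read in T; otherwise the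
    tower is built on the letter at which reading stops. *)
Lemma reduced_word_separation (T : finType) (E : L -> T -> T -> Prop) x w :
    folded E -> reduced w -> ~ follows E x w x ->
  exists (U : finType) (rho : L -> U -> U) (u : U),
    [/\ #|U| <= #|T| * (size w).+1, commuting rho,
        forall w', follows E x w' x -> run rho u w' = u & run rho u w <> u].
Proof.
move=> EF red open_w; case: (follows_or_stops E x w) => [[y xy]|].
  have rhoP := completionP EF.
  exists T, (completion E), x; split.
  - exact: leq_pmulr.
  - by split; [exact: completes_cancel rhoP|exact: completes_comm rhoP].
  - by move=> w'; apply: run_follows.
  - by rewrite (run_follows rhoP xy) => yx; apply: open_w; rewrite -{2}yx.
move=> [w1 [a [w2 [c [Ew xc stop]]]]].
pose vs := chain a w2.
have climb : climbing (a :: vs).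
  by apply: chain_climbing; apply: (reduced_suffix (w1 := w1)); rewrite -Ew.
have TF := tower_folded EF climb; have rhoP := completionP TF.
exists (T * 'I_(size (a :: vs)).+1)%type.
exists (completion (tower E (v:=a) (vs:=vs))), (x, ord0).
split.
- rewrite card_prod card_ord leq_mul2l; apply/orP; right.
  rewrite ltnS Ew size_cat /= addnS ltnS (leq_trans (size_chain _ _)) //.
  exact: leq_addl.
- by split; [exact: completes_cancel rhoP|exact: completes_comm rhoP].
- by move=> w' xx; apply: (run_follows rhoP); exact: follows_tower.
rewrite {1}Ew run_cat (run_follows rhoP (follows_tower a vs xc)).
have up : tower E (v:=a) (vs:=vs) a (c, ord0) (c, inord 1).
  by apply: Or32; split=> //=; rewrite inordK.
have := run_climb EF climb rhoP (w := w2) (c := a) (i := 0) (s := (c, inord 1)).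
rewrite /= drop0 inordK // => /(_ erefl erefl erefl stop) top.
by rewrite [run _ _ _]/= (completes_edge rhoP up) => back; rewrite back in top.
Qed.

End LabelledGraphs.

(** Quotients of folded graphs by a map cl whose fibres have the same outgoing
    edges, as for the orbits of a group of automorphisms; then the paths of the
    quotient lift. *)
Section Quotient.
Variables (L : Type) (inv : L -> L) (lk : rel L).
Variables (V T : Type) (E : L -> V -> V -> Prop) (cl : V -> T).
Hypothesis E_folded : folded inv lk E.
Hypothesis E_cl : forall a v v' w, cl v = cl v' -> E a v w ->
  exists2 w', E a v' w' & cl w' = cl w.

Definition quotient_graph a s t : Prop :=
  exists v w, [/\ cl v = s, cl w = t & E a v w].

Lemma quotient_folded : folded inv lk quotient_graph.
Proof.
split=> [a s t [v [w [vs wt vw]]]|a s t u [v [w [vs wt vw]]] [v' [w' [vs' wt' vw']]]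
        |a b s t u ab [v [w [vs wt vw]]] [v' [w' [vs' wt' vw']]]].
- by exists w, v; split=> //; exact: (folded_inv E_folded vw).
- have [||w2 vw2 w2t] := @E_cl a v v' w; rewrite ?vs ?vs' //.
  by rewrite -wt -wt' -w2t (folded_det E_folded vw2 vw').
- have [||w2 vw2 w2t] := @E_cl b v' v w'; rewrite ?vs ?vs' //.
  have [z wz w2z] := folded_square E_folded ab vw vw2.
  by exists (cl z); [exists w, z|exists w2, z; rewrite w2t].
Qed.

Lemma follows_quotient v l w :
  follows E v l w -> follows quotient_graph (cl v) l (cl w).
Proof.
elim: l v => [|a l IH] v /=; first by move=> ->.
by move=> [u vu /IH]; exists (cl u) => //; exists v, u.
Qed.

Lemma follows_quotient_lift v l t : follows quotient_graph (cl v) l t ->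
  exists2 w, follows E v l w & cl w = t.
Proof.
elim: l v => [|a l IH] v /=; first by move=> <-; exists v.
move=> [s [v' [w' [vv ws vw]]]]; have [w2 vw2 w2s] := E_cl vv vw.
rewrite -ws -w2s => /IH[u w2u ut]; exists u => //.
by exists w2.
Qed.

End Quotient.

(** * Cubes, paths and the labelling by the Salvetti complex *)

Section EdgesOfCubes.
Variables (X : cube_complex) (n : nat) (c : X n).

Lemma src_edge_at i u : src (edge_at c i u) = vert c u.
Proof.
rewrite /src /origin /vert /edge_at -restr_comp.
apply: restr_eq => j; first by case: j.
rewrite /= !ffunE /=; case: existsP => [[k]|_]; last by rewrite addbF.
by rewrite !ffunE andbF.
Qed.

Lemma tgt_edge_at i u :
  tgt (edge_at c i u) = vert c [ffun j => u j (+) (i == j)].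
Proof.
rewrite /tgt /vert /edge_at -restr_comp.
apply: restr_eq => j; first by case: j.
rewrite /= !ffunE /=; congr (_ (+) _); apply/existsP/idP => [[k]|ij].
  by rewrite !ffunE andbT.
by exists ord0; rewrite !ffunE andbT.
Qed.

Lemma eq_vert (u v : {ffun 'I_n -> bool}) : u =1 v -> vert c u = vert c v.
Proof. by move/ffunP->. Qed.

End EdgesOfCubes.

Lemma origin_restr (X : cube_complex) m n (f : face m n) (c : X n) :
  origin (restr f c) = vert c (fbase f).
Proof.
rewrite /origin /vert -restr_comp; apply: restr_eq => j; first by case: j.
rewrite /= ffunE; case: existsP => [[k]|_]; last by rewrite addbF.
by rewrite ffunE andbF.
Qed.

Lemma origin0 (X : cube_complex) (y : X 0) : origin y = y.
Proof. by rewrite -[RHS]restr_id; apply: restr_eq => -[]. Qed.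

Lemma epath_end (X : cube_complex) (x y z : X 0) p :
  epath x p y -> epath x p z -> y = z.
Proof.
elim: p x => [|e p IH] x /=; first by move=> <-.
by move=> [_ ey] [_ ez]; apply: IH ey ez.
Qed.

(** The path is given by faces of the standard cube, so that it can be drawn in
    all cubes at once, in particular in a cube and in its translates. *)
Lemma cube_path n (u : {ffun 'I_n -> bool}) : exists F : seq (face 1 n),
  forall (Y : cube_complex) (c : Y n),
    epath (origin c) (map (fun f => restr f c) F) (vert c u).
Proof.
have [k] := ubnP #|[pred i | u i]|; elim: k u => // k IH u; rewrite ltnS => uk.
case: (pickP [pred i | u i]) => [i /= ui|u0]; last first.
  exists [::] => Y c /=; apply: eq_vert => j.
  by rewrite ffunE; have := u0 j => /= ->.
pose v : {ffun 'I_n -> bool} := [ffun j => u j (+) (i == j)].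
have [|F FP] := IH v.
  apply: leq_trans uk; apply: proper_card; apply/properP; split.
    apply/fintype.subsetP => j; rewrite !inE ffunE.
    by case: eqP => [<-|]; rewrite ?addbF // ui.
  by exists i; rewrite !inE ?ffunE ?ui ?eqxx.
exists (rcons F (edge_face i v)) => Y c; rewrite map_rcons -cats1; apply/epath_cat.
exists (vert c v) => //=; rewrite -/(edge_at c i v) src_edge_at tgt_edge_at.
by split=> //; apply: eq_vert => j; rewrite !ffunE -addbA addbb addbF.
Qed.

Section CubeMaps.
Variables (Y X : cube_complex) (psi : cube_map Y X).

Lemma cmap_vert n (c : Y n) u : psi 0 (vert c u) = vert (psi n c) u.
Proof. exact: cmap_restr. Qed.

Lemma cmap_edge_at n (c : Y n) i u :
  psi 1 (edge_at c i u) = edge_at (psi n c) i u.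
Proof. exact: cmap_restr. Qed.

Lemma cmap_corner_edge n (c : Y n) i :
  psi 1 (corner_edge c i) = corner_edge (psi n c) i.
Proof. exact: cmap_restr. Qed.

Lemma cmap_src e : psi 0 (src e) = src (psi 1 e).
Proof. exact: cmap_vert. Qed.

Lemma cmap_tgt e : psi 0 (tgt e) = tgt (psi 1 e).
Proof. exact: cmap_vert. Qed.

Lemma cmap_erev e : psi 1 (erev e) = erev (psi 1 e).
Proof. exact: cmap_restr. Qed.

Lemma epath_map x p y :
  epath x p y -> epath (psi 0 x) (map (psi 1) p) (psi 0 y).
Proof.
elim: p x => [|e p IH] x /=; first by move=> ->.
by case=> <- /IH; rewrite cmap_src cmap_tgt.
Qed.

Lemma cmap_prev p : map (psi 1) (Defs.prev p) = Defs.prev (map (psi 1) p).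
Proof.
rewrite /Defs.prev map_rev -!map_comp; congr rev.
by apply: eq_map => e /=; rewrite cmap_erev.
Qed.

Lemma elementary_map p q :
  elementary p q -> elementary (map (psi 1) p) (map (psi 1) q).
Proof.
case=> [p' e q'|p' c q']; rewrite !map_cat /=.
  by rewrite cmap_erev; constructor.
by rewrite /corner_edge /edge_at !cmap_restr; exact: across_square.
Qed.

Lemma homotopic_map x y p q : homotopic x y p q ->
  homotopic (psi 0 x) (psi 0 y) (map (psi 1) p) (map (psi 1) q).
Proof.
elim=> {p q} [p q [xp xq el]|p|p q _|p q r _ + _]; last 3 first.
- exact: rst_refl.
- exact: rst_sym.
- exact: rst_trans.
by apply: rst_step; split; [exact: epath_map|exact: epath_map|exact: elementary_map].
Qed.

End CubeMaps.

Definition cmap_comp (Z Y X : cube_complex) (psi : cube_map Y X)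
    (phi : cube_map Z Y) : cube_map Z X.
Proof.
exists (fun n c => psi n (phi n c)) => m n f c.
by rewrite !cmap_restr.
Defined.

Lemma local_isometry_comp (Z Y X : cube_complex) (psi : cube_map Y X)
    (phi : cube_map Z Y) :
  local_isometry psi -> local_isometry phi -> local_isometry (cmap_comp psi phi).
Proof.
move=> [inj1 ext1] [inj2 ext2]; split=> [n c c' occ /= E|z n e c ez oc ec].
  apply: (inj2 _ _ _ occ); apply: inj1 E.
  by rewrite /origin -!cmap_vert; exact: congr1 occ.
have [c1 [o1 e1 <-]] : exists c1 : Y n, [/\ origin c1 = phi 0 z,
    (forall i, corner_edge c1 i = phi 1 (e i)) & psi n c1 = c].
  by apply: ext1 => // i; rewrite -cmap_src ez.
have [c2 [o2 e2 <-]] := ext2 z n e c1 ez o1 (fun i => esym (e1 i)).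
by exists c2.
Qed.

Section Letters.
Variable Gamma : simplicial_graph.

Definition letter : Type := gvert Gamma * bool.
Implicit Types a b : letter.
Definition linv a : letter := (a.1, ~~ a.2).
Definition link : rel letter := fun a b => `[< adj a.1 b.1 >].

Lemma linvK : involutive linv.
Proof. by case=> v b; rewrite /linv /= negbK. Qed.

Lemma link_sym : symmetric link.
Proof. by move=> a b; apply/asboolP/asboolP; apply: adj_sym. Qed.

Lemma link_linv a b : link a b -> link (linv a) b.
Proof. by []. Qed.

Lemma link_irr a : ~~ link a a.
Proof. by apply/asboolP; apply: adj_irr. Qed.

Lemma slab_restr m n (f : face m n) (c : salvetti Gamma n) i :
  slab (restr f c) i =
  ((slab c (fdir f i)).1, (slab c (fdir f i)).2 (+) fbase f (fdir f i)).
Proof. exact: ffunE. Qed.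

Variables (Y : cube_complex) (psi : cube_map Y (salvetti Gamma)).

Definition label (e : Y 1) : letter := slab (psi 1 e) ord0.

Lemma label_erev e : label (erev e) = linv (label e).
Proof. by rewrite /label cmap_erev slab_restr /= !ffunE addbT. Qed.

Lemma label_edge_at n (c : Y n) i (u : {ffun 'I_n -> bool}) : u i = false ->
  label (edge_at c i u) = slab (psi n c) i.
Proof.
move=> ui; rewrite /label cmap_restr slab_restr /= !ffunE ui addbF.
by case: (slab _ _).
Qed.

Lemma label_corner_edge n (c : Y n) i :
  label (corner_edge c i) = slab (psi n c) i.
Proof. by apply: label_edge_at; rewrite ffunE. Qed.

(** Backtracks act trivially because opposite letters act by inverse
    permutations, and the two ways across a square agree because the letters of
    a square are adjacent. *)
Lemma run_homotopic U (rho : letter -> U -> U) x y p q u :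
    commuting linv link rho -> homotopic x y p q ->
  run rho u (map label p) = run rho u (map label q).
Proof.
move=> [rhoK rhoC]; elim=> {p q} [p q [_ _ el]|p|p q _ ->|p q r _ -> _ ->] //.
case: el => [p' e q'|p' c q']; rewrite !map_cat !run_cat /=.
  by rewrite label_erev /run /= rhoK.
rewrite /run /= !label_corner_edge !label_edge_at ?ffunE //.
by rewrite rhoC //; apply/asboolP/slab_adj.
Qed.

Hypothesis psi_isom : local_isometry psi.

Lemma edge_unique e f : src e = src f -> label e = label f -> e = f.
Proof.
move=> ef lef; apply: (psi_isom.1 _ _ _ ef); apply: slab_eq => i.
by rewrite ord1.
Qed.

Lemma path_unique x p y q z : epath x p y -> epath x q z ->
  map label p = map label q -> p = q.
Proof.
elim: p x q => [|e p IH] x [|f q] //= [ex ep] [fx fq] [lef lpq].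
have ef : e = f by apply: edge_unique; rewrite // ex.
by subst f; congr cons; apply: IH lpq; [exact: ep|exact: fq].
Qed.

(** The square spanned by two edges with adjacent labels, in terms of its sides:
    e, followed by f' parallel to f, and f, followed by e' parallel to e. *)
Lemma square_fill e f : src e = src f -> link (label e) (label f) ->
  exists e' f', [/\ src f' = tgt e /\ src e' = tgt f, tgt f' = tgt e',
    label e' = label e, label f' = label f &
    forall p q, elementary (p ++ e :: f' :: q) (p ++ f :: e' :: q)].
Proof.
move=> ef /asboolP lef.
pose l := [ffun i : 'I_2 => if i == ord0 then label e else label f].
have lP i j : i != j -> adj (l i).1 (l j).1.
  case: i j => [[|[|//]] Hi] [[|[|//]] Hj] //= _; rewrite !ffunE //.
  exact: adj_sym.
pose ends (i : 'I_2) := if i == ord0 then e else f.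
have [||i|c [oc ce _]] := psi_isom.2 (src e) 2 ends (SalvettiCube lP).
- by move=> i; rewrite /ends; case: ifP.
- by apply: slab_eq => -[].
- apply: slab_eq => j; rewrite ord1 [RHS]slab_restr /= !ffunE /ends addbF /label.
  by case: ifP => _; case: (slab _ _).
have ce0 : corner_edge c ord0 = e by rewrite ce.
have ce1 : corner_edge c ord_max = f by rewrite ce.
exists (edge_at c ord0 vtx01), (edge_at c ord_max vtx10).
rewrite -ce0 -ce1 !label_corner_edge !label_edge_at ?ffunE //.
rewrite !src_edge_at !tgt_edge_at; split=> //; last by move=> p q; constructor.
  by split; apply: eq_vert => -[[|[|//]] Hi]; rewrite !ffunE.
by apply: eq_vert => -[[|[|//]] Hi]; rewrite !ffunE.
Qed.

Definition edge_graph (a : letter) (s t : Y 0) : Prop :=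
  exists e, [/\ src e = s, tgt e = t & label e = a].

Lemma edge_graph_folded : folded linv link edge_graph.
Proof.
split=> [a s t [e [es et ea]]|a s t u [e [es et ea]] [f [fs fu fa]]
        |a b s t u ab [e [es et ea]] [f [fs fu fb]]].
- by exists (erev e); rewrite src_erev tgt_erev label_erev ea.
- by rewrite -et -fu (@edge_unique e f) ?es ?ea.
have [||e' [f' [[sf' se'] tt le' lf' _]]] := @square_fill e f.
- by rewrite es.
- by rewrite ea fb.
exists (tgt f'); first by exists f'; rewrite sf' lf'.
by exists e'; rewrite se' le'.
Qed.

Lemma follows_edge_graph x w y :
  follows edge_graph x w y <-> exists2 p, epath x p y & map label p = w.
Proof.
split=> [|[p]].
  elim: w x => [|a w IH] x /=; first by move=> ->; exists [::].
  by move=> [z [e [ex ez <-]] /IH[p zp <-]]; exists (e :: p) => //; rewrite /= ez.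
elim: p w x => [|e p IH] [|a w] x //= [ex ep] [ea pw].
by exists (tgt e); [exists e|exact: IH].
Qed.

(** One square moves e behind f: with the square spanned by the reverse of e
    and by f, the path e f becomes f' e2, where f' is parallel to f and e2 to
    e. *)
Lemma slide_edge e m y z : epath y (e :: m) z ->
    all (link (label e)) (map label m) ->
  exists m' e', [/\ epath y (rcons m' e') z,
    homotopic y z (e :: m) (rcons m' e'), size m' = size m & label e' = label e].
Proof.
elim: m e y => [|f m IH] e y.
  by move=> ye _; exists [::], e; split=> //; apply: rst_refl.
move=> [<- [sf fm]] /= /andP[ef em].
have [||e2 [f' [[sf' se2] tt le2 lf' el]]] := @square_fill (erev e) f.
- by rewrite src_erev.
- by rewrite label_erev.
rewrite tgt_erev in sf'; rewrite label_erev in le2.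
have mz : epath (tgt e2) (erev e2 :: m) z by rewrite /= src_erev tgt_erev se2.
have shift : homotopic (src e) z (e :: f :: m) (f' :: erev e2 :: m).
  have p1 : epath (src e) (e :: f :: m) z by [].
  have p2 : epath (src e) (e :: f :: e2 :: erev e2 :: m) z by rewrite /= sf se2.
  have p4 : epath (src e) (f' :: erev e2 :: m) z by rewrite /= sf' tt.
  have p3 : epath (src e) (e :: erev e :: f' :: erev e2 :: m) z.
    by rewrite /= src_erev tgt_erev sf'; split=> //; split=> //; rewrite tt.
  apply: (rst_trans _ _ _ (e :: f :: e2 :: erev e2 :: m)).
    by apply/rst_sym/rst_step; split=> //; exact: (backtrack [:: e; f]).
  apply: (rst_trans _ _ _ (e :: erev e :: f' :: erev e2 :: m)).
    by apply/rst_sym/rst_step; split=> //; exact: (el [:: e]).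
  by apply: rst_step; split=> //; exact: (backtrack [::]).
have [||m' [e' [p h sm le]]] := IH (erev e2) (tgt e2).
- exact: mz.
- by rewrite label_erev le2 linvK.
exists (f' :: m'), e'; split; last 2 first.
- by rewrite /= sm.
- by rewrite le label_erev le2 linvK.
- by rewrite /= sf' tt.
apply: rst_trans shift _; rewrite rcons_cons.
apply: (@homotopic_cat _ _ (tgt e2) _ [:: f'] [:: f']) => //.
exact: rst_refl.
Qed.

Lemma map_catE (T U : Type) (f : T -> U) s t1 t2 : map f s = t1 ++ t2 ->
  exists s1 s2, [/\ s = s1 ++ s2, map f s1 = t1 & map f s2 = t2].
Proof.
move=> E; exists (take (size t1) s), (drop (size t1) s).
by rewrite cat_take_drop map_take map_drop E take_size_cat ?drop_size_cat.
Qed.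

(** Otherwise an edge e slides until it precedes an edge with the inverse
    letter, which is the reverse of e by local injectivity; removing the two
    gives a shorter homotopic path. *)
Lemma shortest_reduced y p z : epath y p z ->
    (forall q, epath y q z -> homotopic y z p q -> size p <= size q) ->
  reduced linv link (map label p).
Proof.
move=> yz short w1 a m w2 /map_catE[p1 [p2 [Ep _]]].
case: p2 Ep => // e p2 Ep [lea] /map_catE[pm [p3 [Ep2 lm]]].
case: p3 Ep2 => // e' p3 Ep2 [lea' _]; apply/negP => am.
move: yz short; rewrite {}Ep {}Ep2 => /epath_cat[u yu [es]].
move=> /epath_cat[v ev [es' vz]].
have [||m' [f [uf h sm lf]]] := @slide_edge e pm u v; first by [].
  by rewrite lea lm.
move: (uf); rewrite -cats1 => /epath_cat[x ux [fs ft]].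
have Ef : e' = erev f.
  by apply: edge_unique; rewrite ?src_erev ?label_erev ?ft // lea' lf lea.
have uz : epath u (m' ++ p3) z.
  by apply/epath_cat; exists x => //; rewrite -fs -tgt_erev -Ef.
have yz' : epath y (p1 ++ m' ++ p3) z by apply/epath_cat; exists u.
have uz' : epath u (e :: pm ++ e' :: p3) z by split=> //; apply/epath_cat; exists v.
suff hom : homotopic y z (p1 ++ e :: pm ++ e' :: p3) (p1 ++ m' ++ p3).
  move/(_ _ yz' hom); rewrite !(size_cat, sm) /= !size_cat /= leq_add2l.
  by rewrite addnS ltnNge leqnSn.
apply: homotopic_cat yu uz' (rst_refl _ _ _) _.
apply: (rst_trans _ _ _ (rcons m' f ++ e' :: p3)).
  by rewrite -cat_cons; apply: homotopic_cat h (rst_refl _ _ _).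
rewrite cat_rcons Ef; apply: rst_step; split=> //; last exact: backtrack.
by apply/epath_cat; exists x => //; split=> //; split; rewrite -?Ef // es'.
Qed.

End Letters.

(** * From labelled graphs to subgroups of finite index *)

Section ExtendedNaturals.
Local Open Scope classical_set_scope.
Local Open Scope card_scope.

Lemma leastn_le (P : set nat) k : P k -> ele (leastn P) (Some k).
Proof.
move=> Pk; rewrite /leastn; case: pselect => [h|[]]; last by exists k; apply/asboolP.
by case: ex_minnP => m _; apply; apply/asboolP.
Qed.

Lemma leastn_attained (P : set nat) n :
  ele (leastn P) (Some n) -> exists2 k, P k & k <= n.
Proof.
rewrite /leastn; case: pselect => //= h; case: ex_minnP => k /asboolP Pk _ kn.
by exists k.
Qed.

Lemma emax_le (A : set enat) n :
  (forall a, A a -> ele a (Some n)) -> ele (emax A) (Some n).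
Proof. exact: leastn_le. Qed.

Lemma emin_le (A : set enat) a n :
  A a -> ele a (Some n) -> ele (emin A) (Some n).
Proof.
case: a => // k Ak kn; have := @leastn_le [set k | A (Some k)] k Ak.
by rewrite /emin; case: leastn => //= m mk; apply: leq_trans kn.
Qed.

Lemma ecard_le (T : Type) (A : set T) n : A #<= `I_n -> ele (ecard A) (Some n).
Proof.
move=> An; have /finite_setP[k Ak] : finite_set A by apply/finite_set_leP; exists n.
have := leastn_le (P := [set k | A #= `I_k]) Ak.
have kn : k <= n by rewrite -card_le_II -(card_le_eql Ak).
by rewrite /ecard; case: leastn => //= m mk; apply: leq_trans kn.
Qed.

Lemma card_finType (U : finType) : [set: U] #<= `I_#|U|.
Proof.
rewrite (card_le_eqr card_II) .
have <- : enum_val @` [set: 'I_#|U|] = [set: U].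
  by apply/seteqP; split=> // u _; exists (enum_rank u); rewrite ?enum_rankK.
exact: card_image_le.
Qed.

Lemma card_le_II_inj (T : Type) (A : set T) k : A #<= `I_k ->
  exists f : T -> nat, (forall a, A a -> f a < k) /\
    forall a b, A a -> A b -> f a = f b -> a = b.
Proof.
move=> /pcard_leP; case=> f; exists f; split=> [a Aa|a b Aa Ab].
  exact: (@funS _ _ _ _ f _ Aa).
by apply: (@inj _ _ _ f); rewrite inE.
Qed.

End ExtendedNaturals.

Section Stabilizers.
Variables (G : groupType) (U : finType) (act : U -> G -> U).
Local Open Scope group_scope.
Local Open Scope classical_set_scope.
Hypothesis act1 : forall u, act u 1 = u.
Hypothesis actM : forall u g h, act u (g * h) = act (act u g) h.

Definition stabilizer u : set G := [set g | act u g = u].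

Lemma actK u g : act (act u g) g^-1 = u.
Proof. by rewrite -actM mulgV act1. Qed.

Lemma subgroup_stabilizer u : subgroup (stabilizer u).
Proof.
split; rewrite /stabilizer /= ?act1 //.
  by move=> g h gu hu; rewrite actM gu.
by move=> g gu; rewrite -{1}gu actK.
Qed.

(** The left coset of g is determined by the image of u under the inverse of
    g, as the action is on the right. *)
Lemma index_stabilizer u : ele (Defs.index (stabilizer u)) (Some #|U|).
Proof.
apply: ecard_le; apply: card_le_trans (card_finType U).
pose fibre v := [set h : G | act u h^-1 = v].
apply: card_le_trans (card_image_le fibre _); apply: subset_card_le.
move=> _ [g ->]; exists (act u g^-1) => //; apply/seteqP; split=> h /=.
  move=> hg; exists (g^-1 * h); last by rewrite mulVKg.
  by rewrite /stabilizer /= actM -hg -actM mulVg act1.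
move=> [d du <-]; rewrite /fibre /= invgM actM; congr act.
by rewrite -{1}(du : act u d = u) actK.
Qed.

End Stabilizers.

Section Loops.
Variables (X : cube_complex) (x : X 0).

Lemma homotopic_epath y z (p q : seq (X 1)) :
  homotopic y z p q -> (epath y p z <-> epath y q z).
Proof.
elim=> {p q} [p q []|p|p q _|p q r _ + _] //; first by tauto.
by move=> -> .
Qed.

Lemma loops_epath (a : pi1 x) p : loops a p -> epath x p x.
Proof. by case: a => l /= [q qx ->] /homotopic_epath[H _]; exact: H. Qed.

Lemma loops_homotopic (a : pi1 x) p q :
  loops a p -> (loops a q <-> homotopic x x p q).
Proof.
case: a => l /= [r _ ->] rp; split=> H.
  exact: rst_trans (rst_sym _ _ _ _ rp) H.
exact: rst_trans rp H.
Qed.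

Lemma loops_one : loops (1%g : pi1 x) [::].
Proof. exact: loops_refl. Qed.

Lemma loops_mul (a b : pi1 x) p q :
  loops a p -> loops b q -> loops (a * b)%g (p ++ q).
Proof.
move=> ap bq; have xa := loops_epath ap; have xb := loops_epath bq.
apply/(loops_homotopic _ (loops_refl (pi1_mul_subproof a b))).
apply: homotopic_cat; [exact: rep_epath|exact: rep_epath| |].
  exact/(loops_homotopic _ (loops_rep a)).
exact/(loops_homotopic _ (loops_rep b)).
Qed.

Lemma loops_inv (a : pi1 x) p : loops a p -> loops a^-1%g (Defs.prev p).
Proof.
move=> ap; have xp := loops_epath ap; have xr := rep_epath a.
apply/(loops_homotopic _ (loops_refl (epath_prev xr))).
have xp' := epath_prev xp; have xr' := epath_prev xr.
have xpp' : epath x (p ++ Defs.prev p) x by apply/epath_cat; exists x.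
have xr'p : epath x (Defs.prev (rep a) ++ p) x by apply/epath_cat; exists x.
have h1 : homotopic x x (Defs.prev (rep a) ++ p ++ Defs.prev p)
    (Defs.prev (rep a) ++ [::]).
  exact: (homotopic_cat xr' xpp' (rst_refl _ _ _) (homotopic_prev xp)).
have h2 : homotopic x x (Defs.prev (rep a) ++ p) [::].
  apply: (rst_trans _ _ _ (Defs.prev (rep a) ++ rep a)).
    apply: (homotopic_cat xr' xp (rst_refl _ _ _)).
    exact/(loops_homotopic _ ap)/loops_rep.
  by have := homotopic_prev xr'; rewrite prevK.
rewrite cats0 catA in h1; apply: rst_trans (rst_sym _ _ _ _ h1) _.
exact: (homotopic_cat xr'p xp' h2 (rst_refl _ _ _)).
Qed.

End Loops.

Lemma multiplicative1 (G H : groupType) (f : {multiplicative G -> H}) :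
  f 1%g = 1%g.
Proof. by apply: (mulgI (f 1%g)); rewrite -gmulfM !mulg1. Qed.

(** For the rest of this part, (T, t) is a folded graph at which exactly the loops
    representing elements of Q close up. *)
Section Separation.
Variables (X : cube_complex) (Gamma : simplicial_graph).
Variable phi : cube_map X (salvetti Gamma).
Hypothesis phi_isom : local_isometry phi.
Variables (x : X 0) (G : groupType) (iota : {multiplicative G -> pi1 x}).
Variables (T : finType) (E : letter Gamma -> T -> T -> Prop) (t : T).
Hypothesis E_folded : folded (@linv Gamma) (@link Gamma) E.
Variable Q : set G.
Hypothesis Q_closes : forall g, Q g ->
  exists2 p, loops (iota g) p & follows E t (map (label phi) p) t.
Hypothesis closing_Q : forall g p,
  loops (iota g) p -> follows E t (map (label phi) p) t -> Q g.

(** A path of X acts on the separating graph of [reduced_word_separation]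
    through its labels, and loops representing the same element of G act in the
    same way. *)
Lemma Dsep_le g p : loops (iota g) p -> ~ Q g ->
  ele (Dsep Q g) (Some (#|T| * (size p).+1)).
Proof.
move=> gp nQg.
pose short n := `[< exists2 q, loops (iota g) q & size q = n >].
have ex_short : exists n, short n by exists (size p); apply/asboolP; exists p.
case: (ex_minnP ex_short) => n /asboolP[q gq <-] min_q.
have qp : size q <= size p by apply: min_q; apply/asboolP; exists p.
have red : reduced (@linv Gamma) (@link Gamma) (map (label phi) q).
  apply: (shortest_reduced phi_isom (loops_epath gq)) => r xr qr.
  by apply: min_q; apply/asboolP; exists r => //; apply/(loops_homotopic _ gq).
have [U [rho [u [cardU rhoC fixu moveu]]]] := reduced_word_separation
  (@linvK Gamma) (@link_sym Gamma) (@link_linv Gamma) (@link_irr Gamma)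
  E_folded red (fun H => nQg (closing_Q gq H)).
pose act v h := run rho v (map (label phi) (rep (iota h))).
have actE v h r : loops (iota h) r -> act v h = run rho v (map (label phi) r).
  move=> hr; apply: run_homotopic rhoC _.
  by apply/(loops_homotopic _ (loops_rep (iota h))).
have act1 v : act v 1%g = v.
  by rewrite (actE _ _ [::]) // multiplicative1; apply: loops_one.
have actM v g1 g2 : act v (g1 * g2)%g = act (act v g1) g2.
  rewrite (actE _ _ (rep (iota g1) ++ rep (iota g2))) ?map_cat ?run_cat //.
  by rewrite gmulfM; apply: loops_mul; apply: loops_rep.
apply: (@emin_le _ (Defs.index (stabilizer act u))); last first.
  have := index_stabilizer act1 actM u; case: Defs.index => //= k kU.
  apply: leq_trans kU (leq_trans cardU _).
  by rewrite leq_mul2l size_map ltnS qp orbT.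
exists (stabilizer act u) => //; split; first exact: subgroup_stabilizer.
- by move=> h /Q_closes[r hr close]; rewrite /stabilizer /= (actE _ _ _ hr) fixu.
- by rewrite /stabilizer /= (actE _ _ _ gq).
Qed.

Variables (S : set G) (M : nat).
Hypothesis S_short : forall g, S g \/ S g^-1%g ->
  exists2 p, loops (iota g) p & size p <= M.

Lemma word_loop w : word S w ->
  exists2 p, loops (iota (\prod_(a <- w) a)%g) p & size p <= M * size w.
Proof.
elim: w => [|a w IH] Sw.
  by rewrite big_nil multiplicative1 muln0; exists [::] => //; apply: loops_one.
have [Sa /IH[p wp pM]] : (S a \/ S a^-1%g) /\ word S w by inversion Sw.
have [q aq qM] := S_short Sa; exists (q ++ p).
  by rewrite big_cons gmulfM; apply: loops_mul.
by rewrite size_cat mulnS leq_add.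
Qed.

(** The additive constant of [Dsep_le] is absorbed because words of length 0
    represent the identity, which belongs to Q. *)
Lemma Sep_le n : ele (Sep S Q n) (Some (M.+1 * #|T| * n)).
Proof.
apply: emax_le => _ [g [nQg /leastn_attained[k [w [Sw wg wk]] kn]] <-].
have [p gp pM] := word_loop Sw; rewrite {}wg {}wk in gp pM.
case: n kn => [|n] kn.
  case: nQg; apply: closing_Q gp _; move: pM; move: kn; rewrite leqn0 => /eqP->.
  by rewrite muln0 leqn0 => /nilP->.
have := Dsep_le gp nQg; case: Dsep => //= m mp; apply: leq_trans mp _.
rewrite [M.+1 * _]mulnC -mulnA leq_mul2l; apply/orP; right.
rewrite mulSn addnC -addn1 leq_add //.
by apply: leq_trans pM _; rewrite leq_mul2l kn orbT.
Qed.

End Separation.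

Section Generators.
Variables (X : cube_complex) (x : X 0) (G : groupType).
Variable iota : {multiplicative G -> pi1 x}.

Lemma short_generators (S : set G) : finite_set S ->
  exists M, forall g, S g \/ S g^-1%g ->
    exists2 p, loops (iota g) p & size p <= M.
Proof.
move=> Sfin.
have /(@finite_seqP _ _)[s Es] := finite_image (fun g => size (rep (iota g))) Sfin.
exists (\max_(i <- s) i).
have bound g : S g -> size (rep (iota g)) <= \max_(i <- s) i.
  move=> Sg; apply: (@leq_bigmax_seq _ s predT id) => //.
  have : [set size (rep (iota g0)) | g0 in S]%classic (size (rep (iota g))) by exists g.
  by rewrite Es.
move=> g [Sg|Sg]; first by exists (rep (iota g)); [exact: loops_rep|exact: bound].
exists (Defs.prev (rep (iota g^-1%g))); last by rewrite size_rev size_map bound.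
have <- : ((iota g^-1)^-1)%g = iota g.
  apply: (mulgI (iota g^-1%g)); rewrite mulgV -gmulfM mulVg.
  by rewrite multiplicative1.
exact/loops_inv/loops_rep.
Qed.

End Generators.

(** * Subgroups represented by compact local isometries *)

Section Represented.
Local Open Scope classical_set_scope.
Local Open Scope card_scope.
Variables (X : cube_complex) (Gamma : simplicial_graph).
Variable phi : cube_map X (salvetti Gamma).
Hypothesis phi_isom : local_isometry phi.
Variables (x : X 0) (G : groupType) (iota : {multiplicative G -> pi1 x}).
Variables (S : set G) (M : nat).
Hypothesis S_short : forall g, S g \/ S g^-1%g ->
  exists2 p, loops (iota g) p & size p <= M.

(** A loop of X whose label word can be read in Z lifts to Z, because edges of X
    at a vertex are determined by their labels.  The vertices of Z are numbered
    to make a finite type of them. *)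
Lemma represented_Sep_le R Q n :
  represented iota R Q -> ele (Sep S Q n) (Some (M.+1 * R * n)).
Proof.
move=> [Z [z [psi [_ _ /leastn_attained[k Zk kR] [psi_isom psiz] ->]]]].
set Q' := [set g | _].
have Zk' : [set: Z 0] #<= `I_k by move: Zk => /card_eqPle[].
have [f [fk f_inj]] := card_le_II_inj Zk'.
pose cl y := Ordinal (fk y I).
have cl_inj y y' : cl y = cl y' -> y = y'.
  by move/(congr1 val); apply: f_inj.
pose E := edge_graph (cmap_comp phi psi).
have EF : folded (@linv Gamma) (@link Gamma) E.
  exact: edge_graph_folded (local_isometry_comp phi_isom psi_isom).
have E_cl a v v' w : cl v = cl v' -> E a v w ->
    exists2 w', E a v' w' & cl w' = cl w.
  by move=> /cl_inj <-; exists w.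
have Q_closes g : Q' g -> exists2 p, loops (iota g) p &
    follows (quotient_graph E cl) (cl z) (map (label phi) p) (cl z).
  move=> [p zp gp]; exists (map (psi 1) p) => //; apply: follows_quotient.
  by apply/follows_edge_graph; exists p; rewrite // -map_comp.
have closing_Q g p : loops (iota g) p ->
    follows (quotient_graph E cl) (cl z) (map (label phi) p) (cl z) -> Q' g.
  move=> gp /(follows_quotient_lift E_cl)[w /follows_edge_graph[q zq lq] /cl_inj wz].
  subst w; exists q => //; rewrite (_ : map _ q = p) //.
  apply: (path_unique phi_isom (epath_map psi zq)); rewrite ?psiz.
    exact: loops_epath gp.
  by rewrite -lq -map_comp.
have := Sep_le phi_isom (quotient_folded EF E_cl) Q_closes closing_Q S_short n.
case: Sep => //= m /leq_trans; apply.
by rewrite card_ord leq_mul2r leq_mul2l kR !orbT.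
Qed.
End Represented.

(** * Path lifting in coverings *)

Section Coverings.
Variables (Y X : cube_complex) (cov : cube_map Y X).
Hypothesis cov_covering : covering cov.

Lemma covering_injective : locally_injective cov.
Proof.
move=> n c c' occ covc; have [|d [_ dP]] := @cov_covering (origin c) n (cov n c).
  by rewrite /origin cmap_vert.
by rewrite -(dP c) // (dP c').
Qed.

Lemma covering_edge e f : src e = src f -> cov 1 e = cov 1 f -> e = f.
Proof. exact: covering_injective. Qed.

Lemma covering_lift y n (c : X n) : origin c = cov 0 y ->
  exists2 c', origin c' = y & cov n c' = c.
Proof. by move/cov_covering => [c' [[? ?] _]]; exists c'. Qed.

Lemma covering_local_isometry : local_isometry cov.
Proof.
split; first exact: covering_injective.
move=> y n e c ey oc ec; have [c' oc' cc'] := covering_lift oc.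
exists c'; split=> // i; apply: covering_injective.
  by rewrite -/(src _) src_edge_at -/(src _) ey -oc'.
by rewrite ec /corner_edge /edge_at cmap_restr cc'.
Qed.

Definition lifts (y : Y 0) (p : seq (X 1)) (w : Y 0) : Prop :=
  exists2 q, epath y q w & map (cov 1) q = p.

Lemma lifts_cat y p q w :
  lifts y (p ++ q) w <-> exists2 v, lifts y p v & lifts v q w.
Proof.
split=> [[r yr /map_catE[s [t [Er <- <-]]]]|[v [s ys <-] [t vt <-]]].
  by move: yr; rewrite Er => /epath_cat[v ys vt]; exists v; [exists s|exists t].
by exists (s ++ t); [apply/epath_cat; exists v|rewrite map_cat].
Qed.

Lemma lifts_cons y e p w :
  lifts y (e :: p) w <-> exists f, [/\ src f = y, cov 1 f = e & lifts (tgt f) p w].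
Proof.
split=> [[[|f q] //= [yf fw] [fe qp]]|[f [yf fe [q fq qp]]]].
  by exists f; split=> //; exists q.
by exists (f :: q); rewrite /= ?fe ?qp.
Qed.

Lemma lifts_unique y p w w' : lifts y p w -> lifts y p w' -> w = w'.
Proof.
elim: p y => [|e p IH] y.
  by move=> [[|//] /= -> _] [[|//] /= -> _].
move=> /lifts_cons[f [yf fe fw]] /lifts_cons[f' [yf' fe' fw']].
have ff : f = f' by apply: covering_edge; rewrite ?fe ?fe' ?yf ?yf'.
by subst f'; apply: IH fw fw'.
Qed.

Lemma lifts_exist y p z : epath (cov 0 y) p z ->
  exists2 w, lifts y p w & cov 0 w = z.
Proof.
elim: p y => [|e p IH] y /=; first by move=> <-; exists y => //; exists [::].
move=> [ey ez]; have [f fy fe] := covering_lift ey.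
have [|w fw wz] := IH (tgt f); first by rewrite cmap_tgt fe.
by exists w => //; apply/lifts_cons; exists f.
Qed.

Lemma lifts_over y p w : lifts y p w -> epath (cov 0 y) p (cov 0 w).
Proof. by move=> [q /(epath_map cov) yq <-]. Qed.

Lemma lifts_square v (c : X 2) q w : origin c = cov 0 v ->
  (lifts v (corner_edge c ord0 :: edge_at c ord_max vtx10 :: q) w <->
   lifts v (corner_edge c ord_max :: edge_at c ord0 vtx01 :: q) w).
Proof.
move=> /covering_lift[d <- <-].
have side i j u : src (edge_at d j u) = tgt (corner_edge d i) ->
  lifts (origin d) (corner_edge (cov 2 d) i :: edge_at (cov 2 d) j u :: q) w <->
  lifts (tgt (edge_at d j u)) q w.
  move=> dij; have di : src (corner_edge d i) = origin d by rewrite src_edge_at.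
  rewrite -cmap_corner_edge -cmap_edge_at.
  split=> [/lifts_cons[e [ed de /lifts_cons[f [fe df]]]]|dw].
    have E : e = corner_edge d i by apply: covering_edge; rewrite ?ed ?di.
    subst e; have -> // : f = edge_at d j u.
    by apply: covering_edge; rewrite ?fe ?dij.
  apply/lifts_cons; exists (corner_edge d i); split=> //.
  by apply/lifts_cons; exists (edge_at d j u).
rewrite !side ?src_edge_at ?tgt_edge_at.
- rewrite (@eq_vert _ _ d _ [ffun j => vtx01 j (+) (ord0 == j)]) //.
  by move=> [[|[|//]] ?]; rewrite !ffunE.
- by apply: eq_vert => -[[|[|//]] ?]; rewrite !ffunE.
- by apply: eq_vert => -[[|[|//]] ?]; rewrite !ffunE.
Qed.

(** Backtracks and squares lift, with uniqueness, so elementary homotopies do not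
    move the endpoint of the lift. *)
Lemma lifts_homotopic y z p p' w : homotopic (cov 0 y) z p p' ->
  lifts y p w -> lifts y p' w.
Proof.
suff H : homotopic (cov 0 y) z p p' -> lifts y p w <-> lifts y p' w by move/H ->.
elim=> {p p'} [p p' [yp _ el]|p|p p' _|p p' p'' _ + _]; last 3 first.
- by [].
- by move->.
- by move->.
case: el yp => [{}p e q|{}p c q] /epath_cat[x yp xq].
  have back v : src e = cov 0 v -> lifts v (e :: erev e :: q) w <-> lifts v q w.
    move=> /covering_lift[f <- <-].
    split=> [/lifts_cons[g [gf ge /lifts_cons[h [hg he hw]]]]|fw].
      have E : g = f by apply: covering_edge.
      subst g; suff E : h = erev f by move: hw; rewrite E tgt_erev.
      by apply: covering_edge; rewrite ?hg ?src_erev // he cmap_erev.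
    apply/lifts_cons; exists f; split=> //; apply/lifts_cons; exists (erev f).
    by rewrite src_erev tgt_erev cmap_erev.
  split=> /lifts_cat[v yv vw]; apply/lifts_cat; exists v => //; apply/back => //;
    by rewrite (epath_end (lifts_over yv) yp); case: xq.
have [ox _] := xq; rewrite src_edge_at -/(origin c) in ox.
split=> /lifts_cat[v yv vw]; apply/lifts_cat; exists v => //;
  have vx := epath_end (lifts_over yv) yp;
  by move: vw; rewrite lifts_square // ox vx.
Qed.

End Coverings.

(** * Deck transformations of the universal cover *)

Section Deck.
Variables (X Xt : cube_complex) (cov : cube_map Xt X).
Hypothesis cov_universal : universal_covering cov.
Let cov_covering : covering cov. Proof. by case: cov_universal. Qed.

Lemma universal_homotopic y z (p q : seq (Xt 1)) :
  epath y p z -> epath y q z -> homotopic y z p q.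
Proof.
have [_ _ trivial] := cov_universal => yp yq.
have zq := epath_prev yq.
have ypq : epath y (p ++ Defs.prev q) y by apply/epath_cat; exists z.
have null : homotopic y y (p ++ Defs.prev q) [::].
  apply: (@loops_class _ _ [::] erefl); rewrite -[pi1_class _]/(1%g : pi1 y).
  by rewrite -(trivial y (pi1_class ypq)); exact: loops_refl.
have cancel_q : homotopic z z (Defs.prev q ++ q) [::].
  by have := homotopic_prev zq; rewrite prevK.
apply: (rst_trans _ _ _ (p ++ Defs.prev q ++ q)).
  have zqq : epath z (Defs.prev q ++ q) z by apply/epath_cat; exists y.
  have := homotopic_cat yp zqq (rst_refl _ _ _) cancel_q.
  by rewrite cats0 => H; apply: rst_sym.
by rewrite catA; exact: (homotopic_cat ypq yq null (rst_refl _ _ _)).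
Qed.

Variables (x : X 0) (xt : Xt 0).
Hypothesis cov_xt : cov 0 xt = x.

(** The cube c' is the image of c under the deck transformation attached to the
    loop p: if r leads from xt to c, then the lift of p followed by the
    projection of r leads to c'.  As a relation, it makes sense before the
    independence of r is known, and inverting p reverses it. *)
Definition translates (p : seq (X 1)) n (c c' : Xt n) : Prop :=
  cov n c = cov n c' /\ exists r s,
  [/\ epath xt r (origin c), epath xt s (origin c') &
      homotopic x (cov 0 (origin c)) (map (cov 1) s) (p ++ map (cov 1) r)].

Lemma cov_origin n (c : Xt n) : cov 0 (origin c) = origin (cov n c).
Proof. exact: cmap_vert. Qed.

Section Translation.
Variable p : seq (X 1).
Hypothesis xp : epath x p x.

Lemma translates_exists n (c : Xt n) : exists c', translates p c c'.
Proof.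
have [_ /(_ xt (origin c))[r xr] _] := cov_universal.
have xr' := epath_map cov xr; rewrite cov_xt in xr'.
have [|w [s xs sE] wE] := @lifts_exist _ _ _ cov_covering xt
  (p ++ map (cov 1) r) (cov 0 (origin c)).
  by rewrite cov_xt; apply/epath_cat; exists x.
have [|c' oc' cc'] := @covering_lift _ _ _ cov_covering w n (cov n c).
  by rewrite -cov_origin wE.
exists c'; split=> //; exists r, s; rewrite oc' sE; split=> //.
exact: rst_refl.
Qed.

(** Two choices of r are homotopic because the cover is simply connected, and the
    lifts of homotopic paths have the same endpoint. *)
Lemma translates_unique n (c c1 c2 : Xt n) :
  translates p c c1 -> translates p c c2 -> c1 = c2.
Proof.
move=> [e1 [r1 [s1 [xr1 xs1 h1]]]] [e2 [r2 [s2 [xr2 xs2 h2]]]].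
apply: (covering_injective cov_covering); last by rewrite -e1.
apply: (@lifts_unique _ _ _ cov_covering xt (map (cov 1) s2)); last by exists s2.
have l1 : lifts cov xt (map (cov 1) s1) (origin c1) by exists s1.
apply: (lifts_homotopic cov_covering (z := cov 0 (origin c)) _ l1).
rewrite cov_xt; apply: rst_trans h1 _; apply: rst_trans (rst_sym _ _ _ _ h2).
have := homotopic_map cov (universal_homotopic xr1 xr2).
have := epath_map cov xr1; rewrite cov_xt => xr1'.
exact: homotopic_cat xp xr1' (rst_refl _ _ _).
Qed.

(** Prolong the paths r and s inside the cubes c and c', by the same faces. *)
Lemma translates_restr m n (f : face m n) (c c' : Xt n) :
  translates p c c' -> translates p (restr f c) (restr f c').
Proof.
move=> [e [r [s [xr xs h]]]]; split; first by rewrite !cmap_restr e.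
have [F FP] := cube_path (fbase f); rewrite !origin_restr.
exists (r ++ map (fun g => restr g c) F), (s ++ map (fun g => restr g c') F).
split; [by apply/epath_cat; exists (origin c)|
  by apply/epath_cat; exists (origin c')|].
have same : map (cov 1) (map (fun g => restr g c') F) =
    map (cov 1) (map (fun g => restr g c) F).
  by rewrite -!map_comp; apply: eq_map => g /=; rewrite !cmap_restr e.
rewrite !map_cat same catA.
have xs' := epath_map cov xs; rewrite cov_xt !cov_origin -e -cov_origin in xs'.
apply: homotopic_cat xs' _ h (rst_refl _ _ _).
exact: epath_map (FP _ c).
Qed.

Lemma translates_inv n (c c' : Xt n) :
  translates p c c' -> translates (Defs.prev p) c' c.
Proof.
move=> [e [r [s [xr xs h]]]]; split=> //; exists s, r; split=> //.
have o : cov 0 (origin c') = cov 0 (origin c) by rewrite !cov_origin e.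
have xr' := epath_map cov xr; rewrite cov_xt in xr'.
have xs' := epath_map cov xs; rewrite cov_xt o in xs'.
rewrite o; have xp' := epath_prev xp; apply: rst_sym.
apply: (rst_trans _ _ _ (Defs.prev p ++ p ++ map (cov 1) r)).
  exact: homotopic_cat xp' xs' (rst_refl _ _ _) h.
have xpp : epath x (Defs.prev p ++ p) x by apply/epath_cat; exists x.
have pp : homotopic x x (Defs.prev p ++ p) [::].
  by have := homotopic_prev xp'; rewrite prevK.
by have := homotopic_cat xpp xr' pp (rst_refl _ _ _); rewrite -catA.
Qed.

Definition translation : cube_map Xt Xt.
Proof.
exists (fun n c => sval (cid (translates_exists c))) => m n f c.
case: cid => c1 h1; case: cid => c2 h2 /=.
exact: translates_unique h1 (translates_restr f h2).
Defined.

Lemma translationP n (c : Xt n) : translates p c (translation n c).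
Proof. by rewrite /=; case: cid. Qed.

End Translation.

Lemma translationK p (xp : epath x p x) n :
  cancel (@translation p xp n) (@translation _ (epath_prev xp) n).
Proof.
move=> c; apply: (translates_unique (epath_prev xp)) (translationP _ _) _.
exact: translates_inv (translationP _ _).
Qed.

Lemma translation_eq p q (xp : epath x p x) (xq : epath x q x) n :
  p = q -> translation xp n =1 translation xq n.
Proof. by move=> E; subst q; rewrite (Prop_irrelevance xp xq). Qed.

Lemma translation_deck p (xp : epath x p x) :
  deck_transformation cov (translation xp).
Proof.
split=> [n|n c]; last by have [<-] := translationP xp c.
exists (translation (epath_prev xp) n); first exact: translationK.
move=> c; rewrite -[RHS](translationK (epath_prev xp)).
by apply: translation_eq; rewrite prevK.
Qed.

Variables (G : groupType) (iota : {multiplicative G -> pi1 x}).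

Lemma acts_as_exists g : exists t, acts_as iota cov xt g t.
Proof.
pose p := rep (iota g); have xp : epath x p x by exact: rep_epath.
exists (translation xp); split; first exact: translation_deck.
have [_ [r [s]]] := translationP xp xt; rewrite !origin0 cov_xt.
move=> [xr xs h]; exists s => //.
apply/(loops_homotopic _ (loops_rep (iota g))); apply: rst_sym.
apply: rst_trans h _.
have xr' := epath_map cov xr; rewrite cov_xt in xr'.
have r0 := homotopic_map cov (universal_homotopic xr (erefl : epath xt [::] xt)).
rewrite cov_xt in r0.
by have := homotopic_cat xp xr' (rst_refl _ _ _) r0; rewrite cats0.
Qed.

Lemma acts_as_comp g h t s :
  acts_as iota cov xt g t -> acts_as iota cov xt h s ->
  acts_as iota cov xt (g * h)%g (cmap_comp t s).
Proof.
move=> [[tb tc] [p xp gp]] [[sb sc] [q xq hq]]; split.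
  split=> [n|n c /=]; first exact: bij_comp.
  by rewrite tc.
exists (p ++ map (t 1) q).
  by apply/epath_cat; exists (t 0 xt) => //; exact: epath_map.
rewrite map_cat -map_comp gmulfM; apply: loops_mul => //.
by rewrite (eq_map (g := cov 1)) // => e /=.
Qed.

Lemma acts_as_inv g t : acts_as iota cov xt g t -> exists s,
  [/\ acts_as iota cov xt g^-1%g s, forall n, cancel (t n) (s n) &
      forall n, cancel (s n) (t n)].
Proof.
move=> [[tb tc] [p xp gp]].
have inv n : {u : Xt n -> Xt n | cancel (t n) u & cancel u (t n)}.
  by apply/cid2; case: (tb n) => u; exists u.
have sr m n (f : face m n) c :
    s2val (inv m) (restr f c) = restr f (s2val (inv n) c).
  case: (inv m) (inv n) => u /= ut tu [v /= vt tv].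
  by apply: (can_inj ut); rewrite tu cmap_restr tv.
pose s := CubeMap sr; exists s.
have st n : cancel (t n) (s n) := s2valP (inv n).
have ts n : cancel (s n) (t n) := s2valP' (inv n).
split=> //; split.
  split=> [n|n c]; first by exists (t n).
  by rewrite -tc ts.
exists (map (s 1) (Defs.prev p)).
  by have := epath_map s (epath_prev xp); rewrite st.
rewrite -map_comp (eq_map (g := cov 1)) => [|e /=]; last by rewrite -tc ts.
rewrite cmap_prev; have -> : iota g^-1%g = (iota g)^-1%g.
  by apply: (mulgI (iota g)); rewrite mulgV -gmulfM mulgV multiplicative1.
exact: loops_inv.
Qed.

End Deck.

(** * Convex hulls and locally finite covers *)

Section Finiteness.
Local Open Scope classical_set_scope.
Local Open Scope card_scope.

Lemma finite_inj (T U : Type) (A : set T) (f : T -> U) :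
    finite_set (f @` A) -> (forall a b, A a -> A b -> f a = f b -> a = b) ->
  finite_set A.
Proof.
move=> fin inj; have /card_eqPle[_ le] : f @` A #= A.
  by apply: inj_card_eq => a b; rewrite !inE; exact: inj.
exact: card_le_finite le fin.
Qed.

Lemma compact_finite_edges (X : cube_complex) :
  compact X -> finite_set [set: X 1].
Proof.
move=> fin; apply: (@finite_inj _ {n : nat & X n} _ (existT (fun n => X n) 1)).
  exact: sub_finite_set fin.
move=> e f _ _; exact: (Eqdep_dec.inj_pair2_eq_dec _ PeanoNat.Nat.eq_dec).
Qed.

Lemma finite_ball (X Y : cube_complex) (cov : cube_map Y X) :
  covering cov -> compact X -> forall K (y : Y 0),
  finite_set [set v | exists2 p, epath y p v & size p <= K].
Proof.
move=> cov_covering X_compact; elim=> [|K IH] y.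
  apply: sub_finite_set (finite_set1 y) => v [[|//] /= yv _]; exact/esym.
have fin : finite_set [set e : Y 1 | src e = y].
  apply: (@finite_inj _ _ _ (cov 1)).
    exact: sub_finite_set (compact_finite_edges X_compact).
  by move=> e f /= ey fy ef; apply: (covering_edge cov_covering) ef; rewrite ey.
apply: sub_finite_set (_ : _ `<=` [set y] `|`
  \bigcup_(e in [set e : Y 1 | src e = y])
    [set v | exists2 p, epath (tgt e) p v & size p <= K]) _.
  move=> v [[|e p] /=]; first by left.
  by move=> [ey ev] pK; right; exists e => //; exists p.
rewrite finite_setU; split; first exact: finite_set1.
exact: bigcup_finite.
Qed.

End Finiteness.

Section Hulls.
Local Open Scope classical_set_scope.
Variables (X Y : cube_complex) (Gamma : simplicial_graph).
Variable psi : cube_map Y (salvetti Gamma).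
Hypothesis psi_isom : local_isometry psi.
Hypothesis Y_simply_connected : forall y z (p q : seq (Y 1)),
  epath y p z -> epath y q z -> homotopic y z p q.

(** The parity of the number of occurrences of the generator v is an invariant
    of homotopy; it is obtained from an action of the letters on two points. *)
Definition parity (v : gvert Gamma) (a : letter Gamma) (b : bool) : bool :=
  b (+) `[< a.1 = v >].

Lemma parity_commuting v : commuting (@linv Gamma) (@link Gamma) (parity v).
Proof.
split=> [a b|a b c _]; first by rewrite /parity /= -addbA addbb addbF.
by rewrite /parity addbAC.
Qed.

(** Every path from y to z uses each of the two distinct generators an odd number
    of times, hence has at least two edges. *)
Lemma corner_geodesic y f e z :
    epath y [:: f; e] z -> link (label psi f) (label psi e) ->
  geodesic y [:: f; e] z.
Proof.
move=> yz fe; split=> // q yq.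
have par v := run_homotopic psi false (parity_commuting v) (Y_simply_connected yq yz).
have ne : (label psi f).1 <> (label psi e).1.
  by move=> E; move/asboolP: fe; rewrite E; apply: adj_irr.
have pf := par (label psi f).1; have pe := par (label psi e).1.
rewrite /run /= /parity asboolT // asboolF in pf; last exact: not_eq_sym.
rewrite /run /= /parity asboolF // asboolT // in pe.
case: q {yq par} pf pe => [|d [|//]] //=.
by move=> /asboolP df /asboolP de; case: ne; rewrite -df.
Qed.

Variable A : forall n, set (Y n).
Hypothesis A_convex : convex A.

Definition convex_graph a (v w : {y | A y}) : Prop :=
  edge_graph psi a (sval v) (sval w).

(** The sides of the square opposite to the given corner s form a geodesic between
    the two neighbours of s ([corner_geodesic]), so they belong to the convex
    subcomplex. *)
Lemma convex_graph_folded : folded (@linv Gamma) (@link Gamma) convex_graph.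
Proof.
have [A_sub _ A_geo] := A_convex; have EF := edge_graph_folded psi_isom.
split=> [a s t|a s t u st su|a b s t u ab [e [es et ea]] [f [fs fu fb]]].
- exact: folded_inv EF _ _ _.
- have := folded_det EF st su; case: t u {st su} => [t At] [u Au] /= E.
  by subst u; rewrite (Prop_irrelevance At Au).
have [||e' [f' [[sf' se'] tt le' lf' _]]] := @square_fill _ _ _ psi_isom e f.
- by rewrite es.
- by rewrite ea fb.
have tu : epath (sval t) [:: f'; erev e'] (sval u).
  by rewrite /= src_erev tgt_erev sf' se' et fu tt.
have geo : geodesic (sval t) [:: f'; erev e'] (sval u).
  apply: corner_geodesic tu _; rewrite lf' label_erev le' ea fb.
  by rewrite link_sym.
have Af' : A f' := List.Forall_inv (A_geo _ _ _ (svalP t) (svalP u) geo).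
have Aw : A (tgt f') by exact: A_sub Af'.
exists (exist _ _ Aw); first by exists f'; rewrite sf' lf'.
by exists e'; rewrite se' le'.
Qed.

Lemma follows_convex_graph v p w : (forall e, List.In e p -> A e) ->
  epath (sval v) p (sval w) -> follows convex_graph v (map (label psi) p) w.
Proof.
have [A_sub _ _] := A_convex.
elim: p v => [|e p IH] [v Av] pA /=.
  by case: w => w Aw /= E; subst w; rewrite (Prop_irrelevance Av Aw).
move=> [ev ew]; have At : A (tgt e) by apply: A_sub; apply: pA; left.
exists (exist _ _ At); first by exists e.
by apply: IH => // f fp; apply: pA; right.
Qed.

Lemma convex_graph_follows v l w : follows convex_graph v l w ->
  exists2 p, epath (sval v) p (sval w) & map (label psi) p = l.
Proof.
move=> H; apply/(follows_edge_graph psi).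
by elim: l v H => [|a l IH] v /= => [->|[u vu /IH]] //; exists (sval u).
Qed.

End Hulls.

(** * Subgroups whose hull stays near the orbit *)

Section Cocompact.
Local Open Scope classical_set_scope.
Local Open Scope card_scope.

Lemma hull_convex (Y : cube_complex) (B : set (Y 0)) : convex (convex_hull B).
Proof.
split=> [m n f c cB A AC BA|n c cB A AC BA|u v p uB vB geo].
- by have [A_sub _ _] := AC; apply: A_sub; exact: cB.
- by have [_ A_full _] := AC; apply: A_full => k f k1; exact: cB.
- apply/List.Forall_forall => e ep A AC BA; have [_ _ A_geo] := AC.
  by move/List.Forall_forall: (A_geo _ _ _ (uB A AC BA) (vB A AC BA) geo); apply.
Qed.

Variables (X Xt : cube_complex) (cov : cube_map Xt X).
Hypothesis cov_universal : universal_covering cov.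
Variables (Gamma : simplicial_graph) (phi : cube_map X (salvetti Gamma)).
Hypothesis phi_isom : local_isometry phi.
Variables (x : X 0) (xt : Xt 0).
Hypothesis cov_xt : cov 0 xt = x.
Variables (G : groupType) (iota : {multiplicative G -> pi1 x}).
Hypothesis iota_inj : injective iota.
Variables (Q : set G).
Hypothesis Q_subgroup : subgroup Q.

Let acts := acts_as iota cov xt.
Let orb := Defs.orbit iota cov xt Q.
Let hull := convex_hull orb.
Let psi := cmap_comp phi cov.

Let psi_isom : local_isometry psi.
Proof.
apply: local_isometry_comp phi_isom _; apply: covering_local_isometry.
by case: cov_universal.
Qed.

(** The preimage under t of a convex subcomplex containing the orbit is again
    such a subcomplex, as t is an automorphism which preserves the orbit. *)
Lemma hull_translate g t n (c : Xt n) :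
  Q g -> acts g t -> hull c -> hull (t n c).
Proof.
move=> Qg gt; have [s [_ ts st]] := acts_as_inv gt.
move=> c_hull A AC orbA; have [A_sub A_full A_geo] := AC.
apply: (c_hull (fun n => [set d | A n (t n d)])).
  split=> [m k f d|k d dA|u v p uA vA [uv geo]] /=.
  - by rewrite cmap_restr; apply: A_sub.
  - by apply: A_full => j f j1; rewrite -cmap_restr; exact: dA.
  - have geo' : geodesic (t 0 u) (map (t 1) p) (t 0 v).
      split=> [|q uq]; first exact: epath_map.
      rewrite size_map -(size_map (s 1) q); apply: geo.
      by have := epath_map s uq; rewrite !ts.
    have := A_geo _ _ _ uA vA geo'; rewrite List.Forall_map.
    by apply: List.Forall_impl.
move=> _ [h [r [Qh hr ->]]]; apply: orbA.
exists (g * h)%g, (cmap_comp t r); split=> //; last exact: acts_as_comp.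
by have [_ QM _] := Q_subgroup; exact: QM.
Qed.

Definition same_orbit (y y' : Xt 0) : Prop :=
  exists g t, [/\ Q g, acts g t & t 0 y = y'].

Lemma same_orbit_sym y y' : same_orbit y y' -> same_orbit y' y.
Proof.
move=> [g [t [Qg gt <-]]]; have [s [gs ts _]] := acts_as_inv gt.
by have [_ _ QV] := Q_subgroup; exists g^-1%g, s; split; [exact: QV| |exact: ts].
Qed.

Lemma same_orbit_trans y y' y'' :
  same_orbit y y' -> same_orbit y' y'' -> same_orbit y y''.
Proof.
move=> [g [t [Qg gt <-]]] [h [s [Qh hs <-]]].
exists (h * g)%g, (cmap_comp s t); split=> //; last exact: acts_as_comp.
by have [_ QM _] := Q_subgroup; exact: QM.
Qed.

Lemma same_orbit_refl y : same_orbit y y.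
Proof.
have [Q1 _ _] := Q_subgroup.
have [t gt] := acts_as_exists cov_universal cov_xt iota 1%g.
have yt : same_orbit y (t 0 y) by exists 1%g, t.
exact: same_orbit_trans yt (same_orbit_sym yt).
Qed.

Lemma orbitP y : orb y <-> same_orbit xt y.
Proof. by split=> [[g [t [Qg gt ->]]]|[g [t [Qg gt <-]]]]; exists g, t. Qed.

Variable K : nat.
Let ball := [set v | ele (dist xt v) (Some K)].
Hypothesis near : @hull 0 `<=` neighborhood K orb.

(** Translate y by the deck transformation which brings a nearby point of the
    orbit back to xt. *)
Lemma near_ball y : hull y -> exists2 b, ball b & same_orbit y b.
Proof.
move=> /near[u /orbitP ux /leastn_attained[k [p yu <-] pK]].
have [g [t [Qg gt tu]]] := same_orbit_sym ux.
exists (t 0 y); last by exists g, t.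
have := epath_prev (epath_map t yu); rewrite tu => ty.
have : ele (dist xt (t 0 y)) (Some (size (Defs.prev (map (t 1) p)))).
  by apply: leastn_le; eexists; first exact: ty.
rewrite size_rev !size_map /ball /=; case: (dist _ _) => //= m mp.
exact: leq_trans mp pK.
Qed.

Lemma ball_card : compact X -> ball #= `I_(growth xt K).
Proof.
move=> X_compact; have fin : finite_set ball.
  have [cov_covering _ _] := cov_universal.
  apply: sub_finite_set (finite_ball cov_covering X_compact K xt) => v.
  by move=> /leastn_attained[k [p xv <-] pK]; exists p.
have /finite_setP[k ballk] := fin.
rewrite /growth /ecard /leastn; case: pselect => [h|[]]; last by exists k; apply/asboolP.
by case: ex_minnP => m /asboolP.
Qed.

(** Number the points of the ball, and send a vertex of the hull to the number of
    a representative of its orbit in the ball, chosen as a function of the orbit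
    alone. *)
Lemma hull_classes : compact X ->
  exists cl : {y : Xt 0 | hull y} -> 'I_(growth xt K),
  forall v w, cl v = cl w <-> same_orbit (sval v) (sval w).
Proof.
move=> X_compact; have /card_eqPle[ballN _] := ball_card X_compact.
have [f [fN f_inj]] := card_le_II_inj ballN.
pose cls y := [set b | ball b /\ same_orbit y b].
have cls_ex (v : {y : Xt 0 | hull y}) : exists b, cls (sval v) b.
  by have [b bB vb] := near_ball (svalP v); exists b.
pose r v := sval (cid (cls_ex v)).
have rP v : cls (sval v) (r v) by exact: svalP.
have r_eq v w : cls (sval v) = cls (sval w) -> r v = r w.
  rewrite /r; move: (cls_ex v) (cls_ex w) => ev ew vw; rewrite vw in ev *.
  by rewrite (Prop_irrelevance ev ew).
exists (fun v => Ordinal (fN _ (rP v).1)) => v w; split.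
  move/(congr1 val) => /= /(f_inj _ _ (rP v).1 (rP w).1) vw.
  apply: same_orbit_trans (rP v).2 _; rewrite vw.
  exact: same_orbit_sym (rP w).2.
move=> vw; apply: val_inj => /=; congr f; apply: r_eq.
apply/seteqP; split=> b [bB] /= yb; split=> //.
  exact: same_orbit_trans (same_orbit_sym vw) yb.
exact: same_orbit_trans vw yb.
Qed.

Variables (S : set G) (M : nat).
Hypothesis S_short : forall g, S g \/ S g^-1%g ->
  exists2 p, loops (iota g) p & size p <= M.

Lemma geodesic_exists (y z : Xt 0) : exists p, geodesic y p z.
Proof.
have [_ /(_ y z)[p yp] _] := cov_universal.
have ex : exists n, `[< exists2 q, epath y q z & size q = n >].
  by exists (size p); apply/asboolP; exists p.
case: (ex_minnP ex) => n /asboolP[q yq <-] min.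
by exists q; split=> // r yr; apply: min; apply/asboolP; exists r.
Qed.

(** An element g of Q is represented by the projection of a geodesic from xt to
    its translate by g, which stays in the hull.  Conversely, a loop which closes
    up in the quotient lifts to a path from xt to a translate of xt by an element
    of Q, and the cover is simply connected. *)
Lemma hull_near_orbit_Sep_le n : compact X ->
  ele (Sep S Q n) (Some (M.+1 * growth xt K * n)).
Proof.
move=> X_compact; have [cl clE] := hull_classes X_compact.
have hull_orb y : same_orbit xt y -> hull y.
  by move=> xy A _; apply; exact/orbitP.
pose v0 : {y : Xt 0 | hull y} := exist _ xt (hull_orb _ (same_orbit_refl xt)).
pose E := convex_graph psi (A := hull).
have EF : folded (@linv Gamma) (@link Gamma) E.
  exact: (convex_graph_folded psi_isom (universal_homotopic cov_universal)
    (hull_convex _)).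
have E_cl a v v' w : cl v = cl v' -> E a v w ->
    exists2 w', E a v' w' & cl w' = cl w.
  move=> /clE[g [t [Qg gt tv]]] [e [ev ew ea]].
  exists (exist _ (t 0 (sval w)) (hull_translate Qg gt (svalP w))); last first.
    by apply/clE; apply: same_orbit_sym; exists g, t.
  exists (t 1 e); rewrite -cmap_src -cmap_tgt ev ew; split=> //.
  by rewrite -ea /label /= gt.1.2.
have Q_closes g : Q g -> exists2 p, loops (iota g) p &
    follows (quotient_graph E cl) (cl v0) (map (label phi) p) (cl v0).
  move=> Qg; have [t gt] := acts_as_exists cov_universal cov_xt iota g.
  have [p geo] := geodesic_exists xt (t 0 xt).
  have xtt : same_orbit xt (t 0 xt) by exists g, t.
  pose v1 : {y : Xt 0 | hull y} := exist _ (t 0 xt) (hull_orb _ xtt).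
  have /clE cl1 : same_orbit (sval v0) (sval v1) by [].
  exists (map (cov 1) p).
    have [_ [q xq gq]] := gt; apply/(loops_homotopic _ gq).
    have := homotopic_map cov (universal_homotopic cov_universal xq geo.1).
    by have [[_ tc] _] := gt; rewrite tc cov_xt.
  rewrite {2}cl1 -map_comp; apply: follows_quotient.
  have [_ _ h_geo] := @hull_convex _ orb.
  apply: (follows_convex_graph psi (hull_convex _) (v := v0) (w := v1) _ geo.1).
  by apply/List.Forall_forall; exact: h_geo (svalP v0) (svalP v1) geo.
have closing_Q g p : loops (iota g) p ->
    follows (quotient_graph E cl) (cl v0) (map (label phi) p) (cl v0) -> Q g.
  move=> gp /(follows_quotient_lift E_cl)[w /convex_graph_follows[q xq lq] /esym/clE].
  move=> [h [t [Qh ht tw]]]; have [_ [r xr hr]] := ht.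
  suff -> : g = h by [].
  apply: iota_inj; apply: (pi1_eqP gp hr).
  have -> : p = map (cov 1) q.
    have xq' := epath_map cov xq; rewrite cov_xt in xq'.
    by apply: (path_unique phi_isom (loops_epath gp) xq'); rewrite -lq -map_comp.
  rewrite tw in xr; have := homotopic_map cov (universal_homotopic cov_universal xq xr).
  by have [[_ tc] _] := ht; rewrite -tw tc cov_xt.
have := Sep_le phi_isom (quotient_folded EF E_cl) Q_closes closing_Q S_short n.
by rewrite card_ord.
Qed.

End Cocompact.

Theorem corollary2 (X : cube_complex) (x : X 0) (G : groupType)
    (iota : {multiplicative G -> pi1 x}) (S : set G)
    (X_compact : compact X) (X_special : special X)
    (iota_bij : bijective iota)
    (S_finite : finite_set S) (S_generates : generates S) :
  (exists P : nat, forall (R : nat) (Q : set G) (n : nat),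
     represented iota R Q -> ele (Sep S Q n) (Some (P * R * n)))
  /\
  (forall (Xt : cube_complex) (cov : cube_map Xt X) (xt : Xt 0),
     universal_covering cov -> cov 0 xt = x ->
     exists P' : nat, forall (K : nat) (Q : set G) (n : nat),
       hull_near_orbit iota cov xt K Q ->
       ele (Sep S Q n) (Some (P' * growth xt K * n))).
Proof.
have [_ [Gamma [phi phi_isom]]] := X_special.
have [M S_short] := short_generators iota S_finite.
split; first by exists M.+1 => R Q n; exact: (represented_Sep_le phi_isom S_short).
move=> Xt cov xt cov_universal cov_xt; exists M.+1 => K Q n [Q_subgroup near].
exact: (hull_near_orbit_Sep_le cov_universal phi_isom cov_xt (bij_inj iota_bij)
  Q_subgroup near S_short).
Qed.
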